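(* Let $d,\tilde d\ge2$, and regard $\mathcal{O}_{d\tilde d}$ as a subalgebra of $\mathcal{O}_d\otimes\mathcal{O}_{\tilde d}$ via the embedding $\iota_{d,\tilde d}$. (a) Let $R\in\mathcal{O}_d$ and $\tilde R\in\mathcal{O}_{\tilde d}$ be unitary. Then the endomorphism $\lambda_R\otimes\lambda_{\tilde R}$ of $\mathcal{O}_d\otimes\mathcal{O}_{\tilde d}$ restricts to an endomorphism of $\mathcal{O}_{d\tilde d}$ if and only if $R\in\mathcal{F}_d$ and $\tilde R\in\mathcal{F}_{\tilde d}$. (b) Let $R\in\mathcal{F}_d^2$ and $\tilde R\in\mathcal{F}_{\tilde d}^2$ be unitary. Then $\iota_{d,\tilde d}(R\boxtimes\tilde R)=R\otimes\tilde R$, and $$(\lambda_R\otimes\lambda_{\tilde R})|_{\mathcal{O}_{d\tilde d}}=\lambda_{R\boxtimes\tilde R}.$$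
   Context: $\mathcal{O}_d$ is the Cuntz algebra generated by isometries $S_1,\dots,S_d$ with $S_i^*S_j=\delta_{ij}1$, $\sum_iS_iS_i^*=1$. $\mathcal{F}_d^n=\mathrm{span}\{S_\mu S_\nu^*:|\mu|=|\nu|=n\}\cong M_d^{\otimes n}$, and $\mathcal{F}_d$ is the norm closure of $\bigcup_n\mathcal{F}_d^n$. An element $T\in\mathrm{End}(\mathbb{C}^d\otimes\mathbb{C}^d)$ with matrix elements $T^{ij}_{kl}=\langle e_i\otimes e_j,T(e_k\otimes e_l)\rangle$ is identified with $\sum T^{ij}_{kl}S_iS_jS_l^*S_k^*\in\mathcal{F}_d^2$. A unitary $u\in\mathcal{O}_d$ defines the unital endomorphism $\lambda_u$ of $\mathcal{O}_d$ with $\lambda_u(S_i)=uS_i$. Let $\tilde S_1,\dots,\tilde S_{\tilde d}$ be the generators of $\mathcal{O}_{\tilde d}$ and $U_{ij}$ ($1\le i\le d$, $1\le j\le\tilde d$) those of $\mathcal{O}_{d\tilde d}$. $\iota_{d,\tilde d}:\mathcal{O}_{d\tilde d}\to\mathcal{O}_d\otimes\mathcal{O}_{\tilde d}$ is the injective $*$-homomorphism with $\iota_{d,\tilde d}(U_{ij})=S_i\otimes\tilde S_j$. $R\boxtimes\tilde R:=F_{23}(R\otimes\tilde R)F_{23}\in\mathrm{End}\big((\mathbb{C}^d\otimes\mathbb{C}^{\tilde d})\otimes(\mathbb{C}^d\otimes\mathbb{C}^{\tilde d})\big)\cong\mathcal{F}_{d\tilde d}^2$, where $F_{23}$ is the flip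 of the two middle tensor factors; in matrix elements, $(R\boxtimes\tilde R)^{(\alpha i)(\beta j)}_{(\gamma k)(\delta l)}=R^{\alpha\beta}_{\gamma\delta}\tilde R^{ij}_{kl}$. *)

(* Defs.v *)
From HB Require Import structures.
From mathcomp Require Import all_boot all_order all_algebra.
From mathcomp Require Import all_classical all_reals all_analysis.
From mathcomp Require Export complex.

Set Implicit Arguments.
Unset Strict Implicit.
Unset Printing Implicit Defensive.

Import Order.TTheory GRing.Theory Num.Theory.
Import numFieldNormedType.Exports.

Local Open Scope classical_set_scope.
Local Open Scope ring_scope.

(* A unital complex C*-algebra.  The multiplication is given on top of the
   Banach space instead of through a joint HB structure, because normed modules
   and noncommutative rings have no join in the hierarchy; the algType instance
   is declared just below.  The norm takes values in the nonnegative reals of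
   R[i].  As usual for rings here, 1 != 0, which excludes the zero algebra. *)
Record cstarType (R : realType) := CStar {
  cstar_banach : completeNormedModType R[i] ;
  cstar_one : cstar_banach ;
  cstar_mul : cstar_banach -> cstar_banach -> cstar_banach ;
  cstar_star : cstar_banach -> cstar_banach ;
  cstar_mulA : associative cstar_mul ;
  cstar_mul1l : left_id cstar_one cstar_mul ;
  cstar_mul1r : right_id cstar_one cstar_mul ;
  cstar_mulDl : left_distributive cstar_mul +%R ;
  cstar_mulDr : right_distributive cstar_mul +%R ;
  cstar_one_neq0 : cstar_one != 0 ;
  cstar_scaleAl : forall (c : R[i]) x y,
    c *: cstar_mul x y = cstar_mul (c *: x) y ;
  cstar_scaleAr : forall (c : R[i]) x y,
    c *: cstar_mul x y = cstar_mul x (c *: y) ;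
  cstar_star_antilinear : forall (c : R[i]) x y,
    cstar_star (c *: x + y) = Num.conj c *: cstar_star x + cstar_star y ;
  cstar_starM : forall x y,
    cstar_star (cstar_mul x y) = cstar_mul (cstar_star y) (cstar_star x) ;
  cstar_starK : involutive cstar_star ;
  cstar_normM : forall x y, `|cstar_mul x y| <= `|x| * `|y| ;
  cstar_identity : forall x, `|cstar_mul (cstar_star x) x| = `|x| ^+ 2 }.

Definition cstar_sort (R : realType) (A : cstarType R) : Type :=
  cstar_banach A.
Coercion cstar_sort : cstarType >-> Sortclass.

HB.instance Definition _ (R : realType) (A : cstarType R) :=
  CompleteNormedModule.copy (cstar_sort A) (cstar_banach A).
HB.instance Definition _ (R : realType) (A : cstarType R) :=
  GRing.Zmodule_isNzRing.Build (cstar_sort A) (@cstar_mulA R A)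
    (@cstar_mul1l R A) (@cstar_mul1r R A) (@cstar_mulDl R A) (@cstar_mulDr R A)
    (@cstar_one_neq0 R A).
HB.instance Definition _ (R : realType) (A : cstarType R) :=
  GRing.Lmodule_isLalgebra.Build R[i] (cstar_sort A) (@cstar_scaleAl R A).
HB.instance Definition _ (R : realType) (A : cstarType R) :=
  GRing.Lalgebra_isAlgebra.Build R[i] (cstar_sort A) (@cstar_scaleAr R A).

Definition star (R : realType) (A : cstarType R) : A -> A := @cstar_star R A.

Definition star_preserving (R : realType) (A B : cstarType R) (f : A -> B) :=
  forall x, f (star x) = star (f x).

Definition unitary_elt (R : realType) (A : cstarType R) (u : A) :=
  star u * u = 1 /\ u * star u = 1.

Record star_subalgebra (R : realType) (A : cstarType R) (D : set A) : Prop := {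
  star_subalgebraZD : forall (c : R[i]) x y, D x -> D y -> D (c *: x + y) ;
  star_subalgebraM : forall x y, D x -> D y -> D (x * y) ;
  star_subalgebra_star : forall x, D x -> D (star x) }.

(* (A, S) is the Cuntz algebra O_d, where d = #|I|.  By Cuntz's theorem it is
   determined up to isomorphism by the relations when d >= 2. *)
Record is_cuntz (R : realType) (I : finType) (A : cstarType R) (S : I -> A) :
    Prop := {
  cuntz_isometry : forall i j, star (S i) * S j = (i == j)%:R ;
  cuntz_sum : \sum_i S i * star (S i) = 1 ;
  cuntz_generated : forall D : set A, closed D -> star_subalgebra D ->
    (forall i, D (S i)) -> D = setT }.

Section FixedPointAlgebra.
Variables (R : realType) (I : finType) (A : cstarType R) (S : I -> A).

Definition word (mu : seq I) : A := \prod_(i <- mu) S i.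

(* The element of F_d^n identified with the T in End((C^d)^{(x) n}) that has
   matrix elements T mu nu = <e_mu, T e_nu>.  For n = 2 the summands are
   T^{ij}_{kl} S_i S_j S_l^* S_k^*. *)
Definition of_matrix n (T : n.-tuple I -> n.-tuple I -> R[i]) : A :=
  \sum_(mu : n.-tuple I) \sum_(nu : n.-tuple I)
    T mu nu *: (word mu * star (word nu)).

Definition Fn n : set A := [set x | exists T, x = @of_matrix n T].

Definition Fd : set A := closure (\bigcup_n Fn n).

(* phi is the endomorphism lambda_u. *)
Definition is_lambda (u : A) (phi : {lrmorphism A -> A}) :=
  star_preserving phi /\ forall i, phi (S i) = u * S i.

End FixedPointAlgebra.

(* T is a C*-completion of the algebraic tensor product of A and B, with
   tens a b in the role of a (x) b; for nuclear A or B, hence for Cuntz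
   algebras, there is only one.  The condition tens_inj says that the linear
   map from the algebraic tensor product to T is injective: a tensor
   \sum_k a_k (x) b_k with linearly independent a_k vanishes only if all the
   b_k do. *)
Record is_cstar_tensor (R : realType) (A B T : cstarType R)
    (tens : A -> B -> T) : Prop := {
  tens_linl : forall b (c : R[i]) a a',
    tens (c *: a + a') b = c *: tens a b + tens a' b ;
  tens_linr : forall a (c : R[i]) b b',
    tens a (c *: b + b') = c *: tens a b + tens a b' ;
  tens1 : tens 1 1 = 1 ;
  tensM : forall a a' b b', tens a b * tens a' b' = tens (a * a') (b * b') ;
  tens_star : forall a b, star (tens a b) = tens (star a) (star b) ;
  tens_inj : forall n (a : 'I_n -> A) (b : 'I_n -> B),
    (forall c : 'I_n -> R[i], \sum_k c k *: a k = 0 -> forall k, c k = 0) ->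
    \sum_k tens (a k) (b k) = 0 -> forall k, b k = 0 ;
  tens_dense : closure [set x | exists n (a : 'I_n -> A) (b : 'I_n -> B),
    x = \sum_k tens (a k) (b k)] = setT }.

(* Phi is the endomorphism phi (x) psi. *)
Definition is_tensor_endo (R : realType) (A B T : cstarType R)
    (tens : A -> B -> T) (phi : A -> A) (psi : B -> B)
    (Phi : {lrmorphism T -> T}) :=
  star_preserving Phi /\ forall a b, Phi (tens a b) = tens (phi a) (psi b).

(* Phi restricts to an endomorphism of B, seen as a subalgebra via iota. *)
Definition restricts_along (B T : Type) (iota : B -> T) (Phi : T -> T) :=
  Phi @` range iota `<=` range iota.

(* F_23 (M (x) N) F_23: the flip F_23 sends the basis index
   ((alpha, i), (beta, j)) to ((alpha, beta), (i, j)). *)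
Definition boxtimes (R : realType) (I J : finType)
    (M : 2.-tuple I -> 2.-tuple I -> R[i])
    (N : 2.-tuple J -> 2.-tuple J -> R[i])
    (mu nu : 2.-tuple (I * J)) : R[i] :=
  M [tuple of map fst mu] [tuple of map fst nu] *
  N [tuple of map snd mu] [tuple of map snd nu].

(* Main.v *)
Require Import Defs.
From HB Require Import structures.
From mathcomp Require Import all_boot all_order all_algebra.
From mathcomp Require Import all_classical all_reals all_analysis.
From mathcomp Require Import ring lra zify.

Set Implicit Arguments.
Unset Strict Implicit.
Unset Printing Implicit Defensive.

Import Order.TTheory GRing.Theory Num.Theory.
Import numFieldNormedType.Exports.
Import ComplexField.Normc.

Local Open Scope classical_set_scope.
Local Open Scope ring_scope.

(** Give [S_mu S_nu^*] the degree [|mu| - |nu|]; the algebra [F] of a Cuntz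
    family is then the closure of the elements of degree zero, and [iota] sends
    an element of degree [p] to a sum of tensors both of whose legs have degree
    [p] ([iota_homog]).  Since [lam] and [lamt] multiply the generators by [u]
    and [ut], the product endomorphism maps [iota (U (i, j))] to the product of
    [tens u ut] and [iota (U (i, j))].  It therefore preserves the range of
    [iota] exactly when [tens u ut] lies in that range
    ([restricts_along_of_tens]), and the theorem is a statement about this one
    element.

    Suppose that it lies in the range.  Then its part of bidegree [(p, q)]
    vanishes for [p != q], so the components satisfy [u_p = 0] or [ut_q = 0]
    ([tens_coefs_eq0], [tens_eq0]).  If some [ut_p] with [p != 0] were nonzero,
    [u] would be homogeneous of degree [p].  This is impossible for a unitary:
    an element [x] of degree [p] has normalised traces of [x^* x] and [x x^*]
    that differ by the factor [d ^ p] ([unitary_degree]).  Hence [ut] has only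
    its component of degree zero and so lies in its algebra [F], and likewise
    [u] ([Fd_of_tens_range]).  Conversely, a tensor of two matrix units of the
    same level is the image of a matrix unit, and the range of [iota] is closed,
    so [tens u ut] is in it when [u] and [ut] are in [F] ([tens_Fd_range]).
    Part (b) is an identity between matrix units ([iota_boxtimes]) together with
    part (a): as [iota] is injective, the restriction is
    [iota^-1 \o Phi \o iota] ([lrmorphism_restriction]).

    The components are obtained without the gauge action.  For finitely many
    homogeneous elements there are isometries [w_i] in the algebra itself with
    [w_i^* x w_j = x] if [x] has degree [i - j], and [0] otherwise
    ([compressors]).  Compressing by them shows that taking a component is a
    contraction ([nrm_component]), also in both legs of a tensor product
    ([nrm_offdiagonal]); compressing by the isometry
    [(w_0 + ... + w_(N-1)) / sqrt N] gives Fejer means, which are thus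
    contractions too, so that an element is recovered in norm from its
    components ([coefs_concentrated]).

    Two facts on star-preserving morphisms remain.  They are contractions: a
    self-adjoint [h] of norm less than 1 is the real part of the unitary
    [h + i sqrt (1 - h^2)], and unitaries go to unitaries ([nrm_morph]).  On the
    algebra of a Cuntz family they are even isometric, so that their ranges are
    closed ([cuntz_isometric], [cuntz_range_closed]): by the C*-identity the norm
    of [x] is determined by those of the powers of [x^* x], and a bound for these
    that loses a factor of polynomial growth loses nothing in the limit
    ([nrm_le_of_pow]). *)

(** * The norm of a C*-algebra as a real number *)

Lemma inv_small (R : realType) (e : R) : 0 < e ->
  exists N : nat, forall n, (N <= n)%N -> n.+1%:R^-1 < e.
Proof.
by move=> e0; have [N _ HN] := near_infty_natSinv_lt (PosNum e0); exists N.
Qed.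

Lemma normc_real (R : realType) (c : R) : 0 <= c -> normc c%:C%C = c.
Proof. by move=> c0; rewrite /normc /= expr0n /= addr0 sqrtr_sqr ger0_norm. Qed.

Lemma normc_nat (R : realType) n : normc (n%:R : R[i]) = n%:R.
Proof. by rewrite -(rmorph_nat (real_complex R)) normc_real. Qed.

Lemma normcVn (R : realType) n : normc (n%:R^-1 : R[i]) = n%:R^-1.
Proof. by rewrite normcV normc_nat. Qed.

Lemma conjC_real (R : realType) (c : R) : Num.conj (c%:C%C : R[i]) = c%:C%C.
Proof. exact: conjc_real. Qed.

Lemma conjCi (R : realType) : Num.conj ('i%C : R[i]) = - 'i%C.
Proof.
rewrite (_ : Num.conj _ = conjc ('i%C : R[i])) //=.
by apply/eqP; rewrite eq_complex /= oppr0 !eqxx.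
Qed.

Section Norm.
Variables (R : realType) (A : cstarType R).
Implicit Types x y : A.

(** The norm of the space takes its values in [R[i]]; its real part gives
    access to the order of [R]. *)
Definition nrm x : R := complex.Re `|x|.

Lemma nrmE x : `|x| = (nrm x)%:C%C.
Proof. by rewrite /nrm RRe_real // ger0_real. Qed.

Lemma nrm_ge0 x : 0 <= nrm x.
Proof. by rewrite -ler0c -nrmE. Qed.

Lemma nrm0 : nrm 0 = 0.
Proof. by rewrite /nrm normr0. Qed.

Lemma nrm_eq0 x : nrm x = 0 -> x = 0.
Proof. by move=> h; apply/normr0_eq0; rewrite nrmE h. Qed.

Lemma nrmD x y : nrm (x + y) <= nrm x + nrm y.
Proof. by rewrite -lecR rmorphD /= -!nrmE ler_normD. Qed.

Lemma nrmN x : nrm (- x) = nrm x.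
Proof. by rewrite /nrm normrN. Qed.

Lemma nrmB x y : nrm (x - y) <= nrm x + nrm y.
Proof. by rewrite -(nrmN y) nrmD. Qed.

Lemma nrm_distC x y : nrm (x - y) = nrm (y - x).
Proof. by rewrite -nrmN opprB. Qed.

Lemma nrm_dist x y z : nrm (x - z) <= nrm (x - y) + nrm (y - z).
Proof. by apply: le_trans (nrmD _ _); rewrite addrA subrK. Qed.

Lemma nrm_le_dist x y : nrm x <= nrm y + nrm (x - y).
Proof. by apply: le_trans (nrmD _ _); rewrite addrC subrK. Qed.

Lemma nrmZ c x : nrm (c *: x) = normc c * nrm x.
Proof. by apply/(@complexI R); rewrite rmorphM /= -!nrmE normrZ. Qed.

Lemma nrmM x y : nrm (x * y) <= nrm x * nrm y.
Proof.
rewrite -lecR rmorphM /= -!nrmE; exact: (cstar_normM (x : cstar_banach A) y).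
Qed.

Lemma nrm_eq0_of_le x : (forall e : R, 0 < e -> nrm x <= e) -> x = 0.
Proof.
move=> h; apply: nrm_eq0; apply/eqP; rewrite eq_le nrm_ge0 andbT.
by apply/ler_addgt0Pr => e e0; rewrite add0r h.
Qed.

Lemma nrm_sum (J : Type) (r : seq J) (P : pred J) (F : J -> A) :
  nrm (\sum_(j <- r | P j) F j) <= \sum_(j <- r | P j) nrm (F j).
Proof.
elim/big_ind2: _ => [|x a y b xa yb|//]; first by rewrite nrm0.
by apply: le_trans (nrmD _ _) _; apply: lerD.
Qed.

Lemma starK : involutive (@star R A).
Proof. exact: cstar_starK. Qed.

Lemma starM x y : star (x * y) = star y * star x.
Proof. exact: cstar_starM. Qed.

Lemma starD x y : star (x + y) = star x + star y.
Proof.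
have : star (1 *: x + y) = Num.conj 1 *: star x + star y.
  exact: (cstar_star_antilinear 1 (x : cstar_banach A)).
by rewrite rmorph1 !scale1r.
Qed.

Lemma star0 : star (0 : A) = 0.
Proof. by apply: (@addIr _ (star 0)); rewrite -starD !add0r. Qed.

Lemma starZ c x : star (c *: x) = Num.conj c *: star x.
Proof.
have : star (c *: x + 0) = Num.conj c *: star x + star 0.
  exact: (cstar_star_antilinear c (x : cstar_banach A)).
by rewrite star0 !addr0.
Qed.

Lemma starN x : star (- x) = - star x.
Proof. by rewrite -scaleN1r starZ rmorphN1 scaleN1r. Qed.

Lemma starB x y : star (x - y) = star x - star y.
Proof. by rewrite starD starN. Qed.

Lemma star1 : star (1 : A) = 1.
Proof. by rewrite -[RHS]starK -[star 1 in RHS]mulr1 starM starK mulr1. Qed.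

Lemma star_sum (J : Type) (r : seq J) (P : pred J) (F : J -> A) :
  star (\sum_(j <- r | P j) F j) = \sum_(j <- r | P j) star (F j).
Proof. exact: (big_morph _ starD star0). Qed.

Lemma nrm_cstar x : nrm (star x * x) = nrm x ^+ 2.
Proof.
apply/(@complexI R); rewrite rmorphXn /= -!nrmE.
exact: (cstar_identity (x : cstar_banach A)).
Qed.

(** The C*-identity gives [|x|^2 <= |x^*| |x|]. *)
Lemma nrm_star x : nrm (star x) = nrm x.
Proof.
wlog suff le : x / nrm x <= nrm (star x).
  by apply/eqP; rewrite eq_le le -{2}(starK x) le.
have [->|x0] := eqVneq (nrm x) 0; first exact: nrm_ge0.
have xp : 0 < nrm x by rewrite lt_def x0 nrm_ge0.
by rewrite -(ler_pM2r xp) -expr2 -nrm_cstar nrmM.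
Qed.

Lemma nrm1 : nrm (1 : A) = 1.
Proof.
have n0 : nrm (1 : A) != 0.
  by apply/eqP => /nrm_eq0/eqP; rewrite oner_eq0.
by apply: (mulfI n0); rewrite -expr2 -nrm_cstar star1 !mulr1.
Qed.

Lemma nrm_isometry x : star x * x = 1 -> nrm x = 1.
Proof.
move=> xx; apply/eqP; rewrite -(@eqrXn2 _ 2) ?nrm_ge0 //.
by rewrite -nrm_cstar xx nrm1 expr1n.
Qed.

Lemma closure_nrmP (D : set A) x :
  closure D x <-> forall e : R, 0 < e -> exists2 y, D y & nrm (x - y) < e.
Proof.
split=> [cl e e0|h B].
  have /cl[y [Dy yB]] : nbhs x (ball x e%:C%C).
    by apply: nbhsx_ballx; rewrite (ltcR 0).
  exists y => //; move: yB; rewrite -ball_normE /= nrmE ltcR //.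
case/nbhs_ballP => e /= e0 sub.
have er : e = (complex.Re e)%:C%C by rewrite RRe_real // gtr0_real.
have [|y Dy ye] := h (complex.Re e); first by rewrite -(ltcR 0) -er.
exists y; split => //; apply: sub; rewrite -ball_normE /= nrmE er ltcR //.
Qed.

Lemma nrm_complete (u : nat -> A) :
  (forall e : R, 0 < e -> exists N, forall m n, (N <= m)%N -> (N <= n)%N ->
     nrm (u m - u n) < e) ->
  exists l, forall e : R, 0 < e -> exists N, forall n, (N <= n)%N ->
     nrm (u n - l) < e.
Proof.
move=> cu.
have : cvg (u @ \oo).
  apply/cauchy_cvgP/cauchy_ballP => e e0.
  have er : e = (complex.Re e)%:C%C by rewrite RRe_real // gtr0_real.
  have [|N HN] := cu (complex.Re e); first by rewrite -(ltcR 0) -er.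
  exists ([set y | exists2 n, (N <= n)%N & y = u n],
          [set y | exists2 n, (N <= n)%N & y = u n]).
    by split; exists N => // n /= Nn; exists n.
  case=> _ _ [[m Nm ->] [n Nn ->]].
  by rewrite -ball_normE /= nrmE er ltcR HN.
move=> /cvg_ex[l ul]; exists l => e e0.
have /ul[N _ HN] : nbhs l (ball l e%:C%C).
  by apply: nbhsx_ballx; rewrite (ltcR 0).
exists N => n Nn; have /= := HN n Nn.
by rewrite -ball_normE /= nrmE ltcR // nrm_distC.
Qed.

End Norm.

(** * Star-preserving morphisms are contractions *)

Section Sqrt.
Variables (R : realType) (A : cstarType R).
Implicit Types x y z h : A.

(** If [z = (y + z^2) / 2] then [(1 - z)^2 = 1 - y]. For [r = |y| < 1] the
    right-hand side is an [r]-contraction of the ball of radius [r], and it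
    preserves self-adjointness and commutation with [h], so its fixed point
    has these properties as well. *)
Lemma sqrt_one_sub y h : star y = y -> nrm y < 1 -> GRing.comm h y ->
  exists b, [/\ star b = b, b * b = 1 - y & GRing.comm h b].
Proof.
move=> sy; set r := nrm y => r1 hy.
have r0 : 0 <= r by exact: nrm_ge0.
pose half : R[i] := (2^-1)%:C%C.
have nhalf : normc half = 2^-1 by rewrite normc_real // invr_ge0.
have chalf : Num.conj half = half by rewrite conjC_real.
pose f z := half *: (y + z * z).
pose D z := [/\ star z = z, GRing.comm h z & nrm z <= r].
have Df z : D z -> D (f z).
  move=> [sz hz zr]; split.
  - by rewrite /f starZ starD starM sz sy chalf.
  - by rewrite /GRing.comm /f -scalerAr -scalerAl mulrDr mulrDl hy mulrA hz
      -mulrA hz mulrA.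
  - rewrite /f nrmZ nhalf ler_pdivrMl // (le_trans (nrmD _ _)) //.
    apply: (@le_trans _ _ (r + r * r)).
      by rewrite lerD // (le_trans (nrmM _ _)) // ler_pM ?nrm_ge0.
    by nra.
have fc z w : D z -> D w -> nrm (f z - f w) <= r * nrm (z - w).
  move=> [_ _ zr] [_ _ wr].
  rewrite /f -scalerBr nrmZ nhalf ler_pdivrMl //.
  have -> : y + z * z - (y + w * w) = z * (z - w) + (z - w) * w.
    by rewrite mulrBr mulrBl addrA subrK opprD addrACA subrr add0r.
  rewrite (le_trans (nrmD _ _)) //.
  rewrite (_ : 2 * _ = r * nrm (z - w) + nrm (z - w) * r); last by ring.
  by rewrite lerD // (le_trans (nrmM _ _)) // ?ler_wpM2r ?ler_wpM2l ?nrm_ge0.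
pose u n := iter n f 0.
have D0 : D 0 by split; rewrite ?star0 ?nrm0 // /GRing.comm mulr0 mul0r.
have Du n : D (u n) by elim: n => // n IH; exact: Df.
(* Applying the contraction [N] times to two points of the ball makes the
   sequence Cauchy. *)
have uc N m n : nrm (u (N + m)%N - u (N + n)%N) <= r ^+ N * (r + r).
  elim: N => [|N IH].
    rewrite !add0n expr0 mul1r (le_trans (nrmB _ _)) // lerD //;
    by have [_ _] := Du m; have [_ _] := Du n.
  rewrite exprS -mulrA (le_trans (fc _ _ (Du _) (Du _))) //.
  by rewrite ler_wpM2l.
have [|l ul] := @nrm_complete _ _ u.
  move=> e e0.
  have : (r ^+ n * (r + r)) @[n --> \oo] --> (0 * (r + r) : R).
    by apply: cvgMl; apply: cvg_expr; rewrite ger0_norm.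
  rewrite mul0r => /cvgrPdist_lt/(_ _ e0)[N _ HN]; exists N => m n Nm Nn.
  have := HN N (leqnn N); rewrite /= sub0r normrN; apply: le_lt_trans.
  by rewrite -(subnKC Nm) -(subnKC Nn) (le_trans (uc _ _ _)) // ler_norm.
have Dl : D l.
  split.
  - apply/eqP; rewrite -subr_eq0; apply/eqP/nrm_eq0_of_le => e e0.
    have [|N /(_ N (leqnn N)) HN] := ul (e / 2); first by rewrite divr_gt0.
    have [su _ _] := Du N; rewrite [e]splitr ltW //.
    apply: le_lt_trans (nrm_dist _ (u N) _) (ltrD _ HN).
    by rewrite -{1}su -starB nrm_star nrm_distC.
  - apply/eqP; rewrite -subr_eq0; apply/eqP/nrm_eq0_of_le => e e0.
    pose M := nrm h + nrm h + 1.
    have M0 : 0 < M by rewrite /M; have := nrm_ge0 h; lra.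
    have [|N /(_ N (leqnn N)) HN] := ul (e / M); first by rewrite divr_gt0.
    have [_ cu _] := Du N.
    have -> : h * l - l * h = (u N - l) * h - h * (u N - l).
      by rewrite mulrBl mulrBr cu opprB [RHS]addrC addrA subrK.
    rewrite (le_trans (nrmB _ _)) //.
    rewrite (le_trans (lerD (nrmM _ _) (nrmM _ _))) //.
    move: HN; rewrite ltr_pdivlMr // /M => HN.
    have := nrm_ge0 (u N - l); have := nrm_ge0 h; nra.
  - apply/ler_addgt0Pr => e e0.
    have [|N /(_ N (leqnn N)) HN] := ul e; first by [].
    have [_ _ ur] := Du N; apply: le_trans (nrm_le_dist _ (u N)) _.
    by rewrite lerD // nrm_distC ltW.
have lf : l = f l.
  apply/eqP; rewrite -subr_eq0; apply/eqP/nrm_eq0_of_le => e e0.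
  have [|N HN] := ul (e / 2); first by rewrite divr_gt0.
  rewrite [e]splitr; apply: le_trans (nrm_dist _ (u N.+1) _) (lerD _ _).
    by rewrite nrm_distC ltW // HN.
  apply: le_trans (fc _ _ (Du _) Dl) _.
  apply: le_trans (ltW (HN N (leqnn N))).
  by rewrite ler_piMl ?nrm_ge0 // ltW.
have [sl hl _] := Dl; exists (1 - l); split.
- by rewrite starB star1 sl.
- have : l + l = y + l * l.
    rewrite {1 2}lf /f -scalerDr -mulr2n -scaler_nat scalerA.
    suff -> : half * 2%:R = 1 by rewrite scale1r.
    rewrite /half -(rmorph_nat (real_complex R)) -rmorphM /= mulVf //.
  move=> E; rewrite -opprB mulrNN -expr2 sqrrB1 mulr2n E expr2.
  by rewrite [y + _]addrC opprD addrA subrr add0r addrC.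
- by rewrite /GRing.comm mulrBr mulrBl mulr1 mul1r hl.
Qed.
End Sqrt.

(** Packs a function that is known to be linear, multiplicative and unital, so
    that the theory of morphisms applies to it. *)
Lemma lrmorphism_of (R : realType) (A B : cstarType R) (f : A -> B) :
  (forall (c : R[i]) x y, f (c *: x + y) = c *: f x + f y) ->
  (forall x y, f (x * y) = f x * f y) -> f 1 = 1 ->
  exists g : {lrmorphism A -> B}, g =1 f.
Proof.
move=> fl fM f1.
pose a1 := GRing.isLinear.Build R[i] A B *:%R f fl.
pose a2 := GRing.isMonoidMorphism.Build A B f (conj f1 fM).
pose g : {lrmorphism A -> B} := HB.pack f a1 a2.
by exists g.
Qed.

Section Contractive.
Variables (R : realType) (A B : cstarType R) (f : {lrmorphism A -> B}).
Hypothesis fs : star_preserving f.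

(** With [b] a square root of [1 - h^2] commuting with [h], the element [h + i
    b] is unitary. Its image is then unitary, hence of norm 1, and [f h] is
    the real part of this image. *)
Lemma nrm_morph_selfadjoint h : star h = h -> nrm h < 1 -> nrm (f h) <= 1.
Proof.
move=> sh h1.
have [|||b [sb bb hb]] := @sqrt_one_sub _ _ (h * h) h.
- by rewrite starM sh.
- by rewrite -{1}sh nrm_cstar expr_lt1 // nrm_ge0.
- by rewrite /GRing.comm mulrA.
pose u := h + 'i%C *: b.
have su : star u = h - 'i%C *: b.
  by rewrite starD starZ sh sb conjCi scaleNr.
have uu : star u * u = 1.
  rewrite su /u mulrDr !mulrDl -!scaleNr -!scalerAl -!scalerAr bb hb scalerA.
  have -> : - 'i%C * 'i%C = 1 :> R[i] by rewrite mulNr -expr2 sqr_i opprK.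
  by rewrite scale1r scaleNr addrA subrK addrC subrK.
have hE : h = (2^-1)%:C%C *: (u + star u).
  rewrite su /u addrACA subrr addr0 -mulr2n -[h *+ 2]scaler_nat.
  rewrite scalerA.
  by rewrite -(rmorph_nat (real_complex R)) -rmorphM /= mulVf // scale1r.
have vv : nrm (f u) = 1.
  by apply: nrm_isometry; rewrite -fs -rmorphM uu rmorph1.
rewrite hE linearZ /= raddfD /= fs nrmZ normc_real ?invr_ge0 //.
rewrite ler_pdivrMl // mulr1 (le_trans (nrmD _ _)) // nrm_star vv.
by rewrite -mulr2n.
Qed.

(** By the C*-identity it suffices to bound [f] on [x^* x], which the
    self-adjoint case does after rescaling. *)
Lemma nrm_morph x : nrm (f x) <= nrm x.
Proof.
rewrite -(@ler_pXn2r _ 2) ?nnegrE ?nrm_ge0 // -!nrm_cstar -fs -rmorphM.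
set h := star x * x.
have sh : star h = h by rewrite starM starK.
apply/ler_addgt0Pr => e e0.
set c := nrm h + e.
have c0 : 0 < c by rewrite ltr_wpDl ?nrm_ge0.
have cV : 0 <= c^-1 by rewrite invr_ge0 ltW.
have : nrm (f ((c^-1)%:C%C *: h)) <= 1.
  apply: nrm_morph_selfadjoint; first by rewrite starZ sh conjC_real.
  by rewrite nrmZ normc_real // ltr_pdivrMl // mulr1 ltrDl.
by rewrite linearZ /= nrmZ normc_real // ler_pdivrMl // mulr1.
Qed.

End Contractive.

(** * Comparing norms through powers *)

Lemma bernoulli_ineq (R : realFieldType) (t : R) n :
  0 <= t -> 1 + n%:R * t <= (1 + t) ^+ n.
Proof.
move=> t0; elim: n => [|n IH]; first by rewrite mul0r addr0.
have n0 : 0 <= n%:R :> R by rewrite ler0n.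
rewrite exprS -natr1; apply: le_trans (_ : _ <= (1 + t) * (1 + n%:R * t)) _.
  by nra.
by rewrite ler_wpM2l // addr_ge0.
Qed.

(** The sequence [2 ^ k] is the one along which the C*-identity computes norms
    of powers. If [b < a], then [(a / b) ^ (2 ^ k)] grows faster than any
    linear function of [2 ^ k]. *)
Lemma le_of_pow_growth (R : realType) (a b C L : R) :
  0 <= b -> 0 <= C -> 0 <= L ->
  (forall k, a ^+ (2 ^ k) <= C * (L * (2 ^ k)%:R + 1) * b ^+ (2 ^ k)) ->
  a <= b.
Proof.
move=> b0 C0 L0 H; rewrite leNgt; apply/negP => ba.
have [bz|bz] := eqVneq b 0.
  by have := H 0%N; rewrite !expr1 bz mulr0 leNgt -[X in X < _]bz ba.
have bp : 0 < b by rewrite lt_def bz.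
pose t := a / b - 1.
have t0 : 0 < t by rewrite subr_gt0 ltr_pdivlMr // mul1r.
have at1 : a = (1 + t) * b by rewrite /t addrC subrK divfK.
have G k : (2 ^ k)%:R * t ^+ 2 <= C * (2 * L + 1).
  have := H k.+1; rewrite at1 exprMn ler_pM2r ?exprn_gt0 //.
  (* Bernoulli's inequality at half the exponent, squared, already bounds the
     power below by a quadratic function of [n]. *)
  rewrite expnS mulnC exprM.
  set n := (2 ^ k)%N => Hn.
  have n1 : 1 <= n%:R :> R by rewrite ler1n expn_gt0.
  have B := @bernoulli_ineq R t n (ltW t0).
  have B2 : (n%:R * t) ^+ 2 <= C * (2 * L + 1) * n%:R.
    apply: (@le_trans _ _ (((1 + t) ^+ n) ^+ 2)).
      by rewrite lerXn2r ?nnegrE //; nra.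
    apply: le_trans Hn _; rewrite -mulrA ler_wpM2l // natrM; nra.
  by rewrite -(@ler_pM2r _ n%:R) ?(lt_le_trans _ n1) //; nra.
pose M := C * (2 * L + 1) / t ^+ 2.
have t2 : 0 < t ^+ 2 by rewrite exprn_gt0.
have := @upper_nthrootP R M _ (leqnn _).
set k := Num.Def.archi_bound _; move=> lt.
have := G k; rewrite -ler_pdivlMr // -/M natrX => le.
by have := lt_le_trans lt le; rewrite ltxx.
Qed.

Section PowerTrick.
Variables (R : realType) (A B : cstarType R) (f : {lrmorphism A -> B}).
Hypothesis fs : star_preserving f.

Lemma nrm_pow2 (D : cstarType R) (x : D) k :
  star x = x -> nrm (x ^+ (2 ^ k)) = nrm x ^+ (2 ^ k).
Proof.
elim: k x => [|k IH] x sx; first by rewrite !expr1.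
rewrite expnS !exprM IH; last by rewrite expr2 starM sx.
by rewrite expr2 -{1}sx nrm_cstar.
Qed.

(** The norm of the [2 ^ k]-th power of [x^* x] is [|x| ^ (2 * 2 ^ k)], so a
    factor of linear growth in the exponent disappears when roots are
    taken. *)
Lemma nrm_le_of_pow (x : A) (C L : R) : 0 <= C -> 0 <= L ->
  (forall k, nrm ((star x * x) ^+ (2 ^ k)) <=
     C * (L * (2 ^ k)%:R + 1) * nrm (f ((star x * x) ^+ (2 ^ k)))) ->
  nrm x <= nrm (f x).
Proof.
move=> C0 L0 H; rewrite -(@ler_pXn2r _ 2) ?nnegrE ?nrm_ge0 //.
apply: (le_of_pow_growth _ C0 L0) => [|k]; first by rewrite exprn_ge0 ?nrm_ge0.
have sx (D : cstarType R) (y : D) : star (star y * y) = star y * y.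
  by rewrite starM starK.
have := H k; rewrite rmorphXn /= rmorphM /= fs !nrm_pow2 ?sx // !nrm_cstar.
by [].
Qed.
End PowerTrick.

(** * Words in a Cuntz family *)

Section Words.
Variables (R : realType) (I : finType) (A : cstarType R) (S : I -> A).
Hypothesis hS : is_cuntz S.
Implicit Types (x y : A) (mu nu : seq I).

Lemma word_nil : word S [::] = 1.
Proof. exact: big_nil. Qed.

Lemma word_cons i mu : word S (i :: mu) = S i * word S mu.
Proof. exact: big_cons. Qed.

Lemma word_cat mu nu : word S (mu ++ nu) = word S mu * word S nu.
Proof. exact: big_cat. Qed.

Lemma word_rcons mu i : word S (rcons mu i) = word S mu * S i.
Proof. by rewrite -cats1 word_cat word_cons word_nil mulr1. Qed.

Lemma word_orth mu nu : size mu = size nu ->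
  star (word S mu) * word S nu = (mu == nu)%:R.
Proof.
elim: mu nu => [|i mu IH] [|j nu] //=; first by rewrite word_nil star1 mulr1.
case=> sz; rewrite !word_cons starM mulrA -(mulrA (star _)) (cuntz_isometry hS).
rewrite eqseq_cons; case: (i == j); last by rewrite mulr0 mul0r.
by rewrite mulr1 IH.
Qed.

Lemma word_isometry mu : star (word S mu) * word S mu = 1.
Proof. by rewrite word_orth ?eqxx. Qed.

(** The canonical endomorphism of the Cuntz algebra. *)
Definition rho x := \sum_i S i * x * star (S i).

Lemma rho1 : rho 1 = 1.
Proof. by rewrite -[RHS](cuntz_sum hS); apply: eq_bigr => i _; rewrite mulr1. Qed.

Lemma rho0 : rho 0 = 0.
Proof. by rewrite /rho big1 // => i _; rewrite mulr0 mul0r. Qed.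

Lemma rho_gen x i : rho x * S i = S i * x.
Proof.
rewrite mulr_suml (bigD1 i) //= big1 => [|j ji].
  by rewrite addr0 -mulrA (cuntz_isometry hS) eqxx mulr1.
by rewrite -mulrA (cuntz_isometry hS) (negPf ji) mulr0.
Qed.

Lemma rhoM x y : rho (x * y) = rho x * rho y.
Proof.
by rewrite [in RHS]/rho mulr_sumr; apply: eq_bigr => i _; rewrite !mulrA rho_gen.
Qed.

Lemma rho_star x : rho (star x) = star (rho x).
Proof. by rewrite star_sum; apply: eq_bigr => i _; rewrite !starM starK mulrA. Qed.

Lemma rhon1 n : iter n rho 1 = 1.
Proof. by elim: n => //= n ->; rewrite rho1. Qed.

Lemma rhon0 n : iter n rho 0 = 0.
Proof. by elim: n => //= n ->; rewrite rho0. Qed.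

Lemma rhonM n x y : iter n rho (x * y) = iter n rho x * iter n rho y.
Proof. by elim: n => //= n ->; rewrite rhoM. Qed.

Lemma rhon_star n x : iter n rho (star x) = star (iter n rho x).
Proof. by elim: n => //= n ->; rewrite rho_star. Qed.

(** The [k]-th power of [rho] maps into the commutant of the matrix algebra
    spanned by the [S_mu S_nu^*] with [|mu| = |nu| = k]; this is the form of
    that fact for a single word. *)
Lemma rhon_word n x mu :
  iter (size mu + n) rho x * word S mu = word S mu * iter n rho x.
Proof.
elim: mu => [|i mu IH]; first by rewrite word_nil mulr1 mul1r.
by rewrite word_cons addSn iterS mulrA rho_gen -!mulrA IH.
Qed.

Lemma rhon_sum n x :
  iter n rho x = \sum_(mu : n.-tuple I) word S mu * x * star (word S mu).
Proof.
elim: n => [|n IH].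
  rewrite (big_pred1 [tuple]) => [|t]; last by rewrite [t]tuple0 /= eqxx.
  by rewrite word_nil star1 mulr1 mul1r.
rewrite (reindex (fun p : I * n.-tuple I => [tuple of p.1 :: p.2])) /=; last first.
  exists (fun t => (thead t, [tuple of behead t])) => [[i t]|t] _ /=.
    by rewrite theadE; congr (_, _); apply: val_inj.
  by rewrite -tuple_eta.
rewrite -(pair_bigA _ (fun i (t : n.-tuple I) =>
  word S (i :: t) * x * star (word S (i :: t)))) /= IH.
apply: eq_bigr => i _; rewrite mulr_sumr mulr_suml; apply: eq_bigr => t _.
by rewrite word_cons starM !mulrA.
Qed.

Lemma word_sum n : \sum_(mu : n.-tuple I) word S mu * star (word S mu) = 1.
Proof.
by rewrite -[RHS](rhon1 n) rhon_sum; apply: eq_bigr => mu _; rewrite mulr1.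
Qed.

(** The span of the [S_mu S_nu^*] with [|mu| = m] and [|nu| = n], described by
    the values of the coefficients instead of by a linear combination: [c] is
    the coefficient of [S_mu S_nu^*]. Closure under sums, products and
    adjoints is then immediate. *)
Definition block m n x := forall mu nu, size mu = m -> size nu = n ->
  exists c : R[i], star (word S mu) * x * word S nu = c%:A.

Lemma blockZD m n c x y : block m n x -> block m n y -> block m n (c *: x + y).
Proof.
move=> bx by_ mu nu smu snu; have [a ax] := bx _ _ smu snu.
have [b yb] := by_ _ _ smu snu; exists (c * a + b).
by rewrite mulrDr mulrDl yb -scalerAr -scalerAl ax scalerA -scalerDl.
Qed.

Lemma block0 m n : block m n 0.
Proof. by move=> mu nu _ _; exists 0; rewrite mulr0 mul0r scale0r. Qed.

Lemma blockD m n x y : block m n x -> block m n y -> block m n (x + y).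
Proof. by move=> bx by_; rewrite -[x]scale1r; apply: blockZD. Qed.

Lemma blockZ m n c x : block m n x -> block m n (c *: x).
Proof. by move=> bx; rewrite -[_ *: x]addr0; apply: blockZD => //; apply: block0. Qed.

Lemma block_sum m n (J : Type) (r : seq J) (P : pred J) (F : J -> A) :
  (forall j, P j -> block m n (F j)) -> block m n (\sum_(j <- r | P j) F j).
Proof. by move=> H; elim/big_ind: _ => //; [exact: block0|exact: blockD]. Qed.

Lemma block_word mu nu :
  block (size mu) (size nu) (word S mu * star (word S nu)).
Proof.
move=> mu' nu' smu snu; exists ((mu' == mu)%:R * (nu == nu')%:R).
rewrite mulrA -mulrA !word_orth // -scalerA !scaler_nat.
by rewrite -[RHS]mulr_natl !mulr_natl.
Qed.

Lemma block_gen i : block 1 0 (S i).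
Proof.
have := @block_word [:: i] [::].
by rewrite word_cons word_nil star1 !mulr1.
Qed.

Lemma block_one : block 0 0 1.
Proof. by have := @block_word [::] [::]; rewrite word_nil star1 mulr1. Qed.

Lemma block_star m n x : block m n x -> block n m (star x).
Proof.
move=> bx mu nu smu snu; have [c cx] := bx _ _ snu smu.
exists (Num.conj c); rewrite -[1 in RHS]star1 -starZ -cx.
by rewrite !starM starK mulrA.
Qed.

Lemma block_raise1 m n x : block m n x -> block m.+1 n.+1 x.
Proof.
move=> bx mu nu; case/lastP: mu => // mu i; case/lastP: nu => // nu j.
rewrite !size_rcons => -[smu] [snu]; have [c cx] := bx _ _ smu snu.
exists (c * (i == j)%:R); rewrite !word_rcons starM.
rewrite !mulrA -(mulrA (star (S i))) -(mulrA (star (S i))) cx -scalerAr mulr1.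
by rewrite -scalerAl (cuntz_isometry hS) -scalerA scaler_nat.
Qed.

Lemma block_raise k m n x : block m n x -> block (m + k) (n + k) x.
Proof.
by move=> bx; elim: k => [|k IH]; rewrite ?addn0 // !addnS; apply: block_raise1.
Qed.

(** Insert the resolution of unity [word_sum] by words of length [n] between
    the two factors. *)
Lemma blockM m n p x y : block m n x -> block n p y -> block m p (x * y).
Proof.
move=> bx by_ mu nu smu snu.
have /choice[a ax] (t : n.-tuple I) :
  exists c, star (word S mu) * x * word S t = c%:A by apply: bx; rewrite ?size_tuple.
have /choice[b yb] (t : n.-tuple I) :
  exists c, star (word S t) * y * word S nu = c%:A by apply: by_; rewrite ?size_tuple.
exists (\sum_t a t * b t).
rewrite -[x]mulr1 -[in LHS](word_sum n) !mulr_sumr !mulr_suml scaler_suml mulr_sumr.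
rewrite mulr_suml; apply: eq_bigr => t _.
transitivity (star (word S mu) * x * word S t *
  (star (word S t) * y * word S nu)); first by rewrite !mulrA.
by rewrite ax yb -scalerAl mul1r scalerA.
Qed.
End Words.

(** * Degrees and compressions *)

Section Graded.
Variables (R : realType) (I : finType) (A : cstarType R) (S : I -> A).
Hypothesis hS : is_cuntz S.
Implicit Types x y : A.

(** Insert [word_sum] on both sides of [x]. *)
Lemma block_expand m n x : block S m n x ->
  exists c : m.-tuple I -> n.-tuple I -> R[i],
    (forall (mu : m.-tuple I) (nu : n.-tuple I),
        star (word S mu) * x * word S nu = (c mu nu)%:A) /\
    x = \sum_(mu : m.-tuple I) \sum_(nu : n.-tuple I)
          c mu nu *: (word S mu * star (word S nu)).
Proof.
move=> bx.
have /choice[c cx] (p : m.-tuple I * n.-tuple I) :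
    exists c, star (word S p.1) * x * word S p.2 = c%:A.
  by apply: bx; rewrite size_tuple.
exists (fun mu nu => c (mu, nu)); split=> [mu nu|]; first exact: (cx (mu, nu)).
rewrite -[LHS]mul1r -[LHS]mulr1 -{1}(word_sum hS m) -(word_sum hS n).
rewrite mulr_suml mulr_suml; apply: eq_bigr => mu _.
rewrite mulr_sumr; apply: eq_bigr => nu _.
transitivity (word S mu * (star (word S mu) * x * word S nu) * star (word S nu)).
  by rewrite !mulrA.
by rewrite (cx (mu, nu)) -scalerAr mulr1 scalerAl.
Qed.

Lemma Fn_block n x : Fn S n x <-> block S n n x.
Proof.
split=> [[c ->]|/block_expand[c [_ xE]]]; last by exists c.
apply: block_sum => mu _; apply: block_sum => nu _; apply: blockZ.
by have := @block_word _ _ _ _ hS mu nu; rewrite !size_tuple.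
Qed.

Definition homog (p : int) x :=
  exists m n : nat, p = m%:Z - n%:Z /\ block S m n x.

(** Two blocks with the same difference [m - n] both embed in a larger one, by
    [block_raise]. *)
Lemma homog_block2 p x y : homog p x -> homog p y ->
  exists m n : nat, [/\ p = m%:Z - n%:Z, block S m n x & block S m n y].
Proof.
move=> [m [n [pE bx]]] [m' [n' [pE' by_]]].
exists (m + m')%N, (n + m')%N; split; first by lia.
  exact: block_raise.
have -> : (m + m' = m' + m)%N by lia.
have -> : (n + m' = n' + m)%N by lia.
exact: block_raise.
Qed.

Lemma homogD p x y : homog p x -> homog p y -> homog p (x + y).
Proof.
move=> hx hy; have [m [n [pE bx by_]]] := homog_block2 hx hy.
by exists m, n; split => //; apply: blockD.
Qed.

Lemma homog0 p : homog p 0.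
Proof.
(* The levels [m] and [n] only have to be natural numbers with difference
   [p]. *)
exists `|p|%N, `| `|p|%N%:Z - p|%N; split; [lia | exact: block0].
Qed.

Lemma homogZ p c x : homog p x -> homog p (c *: x).
Proof. by move=> [m [n [pE bx]]]; exists m, n; split => //; apply: blockZ. Qed.

Lemma homog_sum p (J : Type) (r : seq J) (P : pred J) (F : J -> A) :
  (forall j, P j -> homog p (F j)) -> homog p (\sum_(j <- r | P j) F j).
Proof. by move=> H; elim/big_ind: _ => //; [exact: homog0|exact: homogD]. Qed.

Lemma homogM p q x y : homog p x -> homog q y -> homog (p + q) (x * y).
Proof.
move=> [m [n [-> bx]]] [m' [n' [-> by_]]].
exists (m + m')%N, (n' + n)%N; split; first lia.
apply: (@blockM _ _ _ _ hS _ (n + m')).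
  exact: block_raise.
by rewrite addnC; apply: block_raise.
Qed.

Lemma homog_star p x : homog p x -> homog (- p) (star x).
Proof.
by move=> [m [n [-> bx]]]; exists n, m; split; [lia | exact: block_star].
Qed.

Lemma homog_gen i : homog 1 (S i).
Proof. by exists 1%N, 0%N; split => //; apply: block_gen. Qed.

Lemma homog_one : homog 0 1.
Proof. by exists 0%N, 0%N; split => //; apply: block_one. Qed.

(** A word [v] that does not overlap its own translates: [v = i i ... i j],
    with [K] letters [i] followed by a different letter [j]. *)
Lemma shift_isometry K : (1 < #|I|)%N ->
  exists v, star v * v = 1 /\
    forall a, (0 < a)%N -> (a <= K)%N -> star v * iter a (rho S) v = 0.
Proof.
case/card_gt1P => i [j [_ _ ij]].
pose v := word S (rcons (nseq K i) j).
exists v; split; first exact: word_isometry.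
move=> a a0 aK.
have vE : v = word S (nseq a i) * (word S (nseq (K - a) i) * S j).
  by rewrite /v word_rcons mulrA -word_cat -nseqD subnKC.
have vE' : v = word S (nseq (K - a) i) * word S (nseq a i) * S j.
  by rewrite /v word_rcons -word_cat -nseqD subnK.
have E : star (word S (nseq a i)) * iter a (rho S) v = v * star (word S (nseq a i)).
  apply: (can_inj (@starK R A)); rewrite !starM !starK -rhon_star.
  by have := rhon_word hS 0 (star v) (nseq a i); rewrite size_nseq addn0.
rewrite {1}vE starM -mulrA E starM mulrA {1}vE'.
have -> : star (S j) * star (word S (nseq (K - a) i)) *
    (word S (nseq (K - a) i) * word S (nseq a i) * S j) =
    star (S j) * (star (word S (nseq (K - a) i)) * word S (nseq (K - a) i)) *
     word S (nseq a i) * S j by rewrite !mulrA.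
rewrite word_isometry // mulr1; case: a a0 {aK vE vE' E} => // a _.
rewrite [nseq _ _]/= word_cons !mulrA (cuntz_isometry hS).
by rewrite eq_sym (negPf ij) !mul0r.
Qed.

(** The translates [rho^a v] are orthogonal isometries as long as the
    translations differ by at most [K]. *)
Lemma shift_orth K v : star v * v = 1 ->
  (forall a, (0 < a)%N -> (a <= K)%N -> star v * iter a (rho S) v = 0) ->
  forall a b, (a <= b + K)%N -> (b <= a + K)%N ->
  star (iter a (rho S) v) * iter b (rho S) v = (a == b)%:R.
Proof.
move=> vv v0; have H a d : (d <= K)%N ->
    star (iter a (rho S) v) * iter (a + d) (rho S) v = (d == 0%N)%:R.
  move=> dK; rewrite iterD -rhon_star -rhonM //.
  case: d dK => [|d] dK; first by rewrite /= vv rhon1.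
  by rewrite v0 // rhon0.
move=> a b; case: (leqP a b) => ab le1 le2.
  by rewrite -{1}(subnKC ab) H; [congr (nat_of_bool _)%:R; lia|lia].
apply: (can_inj (@starK R A)); rewrite starM starK.
rewrite -{1}(subnKC (ltnW ab)) H; last lia.
by rewrite (_ : (a - b == 0)%N = (a == b)); [case: eqP; rewrite ?star1 ?star0|lia].
Qed.

(** [rho^(k+j) v] can be moved to the left through the word [S_nu^*], which
    lowers the power of [rho] by [|nu|], and likewise on the other side; what
    remains between the words is a product of two translates of [v], and they
    match exactly when the degree is [i - j]. *)
Lemma compress_block K k v m n x i j : star v * v = 1 ->
  (forall a, (0 < a)%N -> (a <= K)%N -> star v * iter a (rho S) v = 0) ->
  (m <= k)%N -> (n <= k)%N -> (k + i <= K)%N -> (k + j <= K)%N -> block S m n x ->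
  star (iter (k + i) (rho S) v) * x * iter (k + j) (rho S) v =
  (m%:Z - n%:Z == i%:Z - j%:Z)%:R *: x.
Proof.
move=> vv v0 mk nk iK jK /block_expand[c [_ ->]].
rewrite mulr_sumr mulr_suml scaler_sumr; apply: eq_bigr => mu _.
rewrite mulr_sumr mulr_suml scaler_sumr; apply: eq_bigr => nu _.
rewrite -scalerAr -scalerAl scalerA mulrC -scalerA; congr (_ *: _).
have E1 : star (iter (k + i) (rho S) v) * word S mu =
    word S mu * star (iter (k - m + i) (rho S) v).
  have := rhon_word hS (k - m + i) (star v) mu.
  by rewrite !rhon_star size_tuple addnA subnKC.
have E2 : star (word S nu) * iter (k + j) (rho S) v =
    iter (k - n + j) (rho S) v * star (word S nu).
  apply: (can_inj (@starK R A)); rewrite !starM starK.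
  have := rhon_word hS (k - n + j) (star v) nu.
  by rewrite !rhon_star size_tuple addnA subnKC.
rewrite mulrA E1 -mulrA -mulrA E2 (mulrA (star _)) (shift_orth vv v0); try lia.
rewrite (_ : (k - m + i == k - n + j)%N = (m%:Z - n%:Z == i%:Z - j%:Z)); last lia.
by case: eqP => _; rewrite ?mul1r ?scale1r // mul0r mulr0 scale0r.
Qed.

(** A list of pairs (degree, element) stands for a formal Laurent polynomial.
    Working with lists keeps the degree components of a sum available before
    it is known that the sum determines them. *)
Definition graded (s : seq (int * A)) := forall t, t \in s -> homog t.1 t.2.

Definition value (s : seq (int * A)) := \sum_(t <- s) t.2.

Definition component (p : int) (s : seq (int * A)) :=
  \sum_(t <- s | t.1 == p) t.2.

Lemma graded_level s : graded s -> exists k : nat, forall t, t \in s ->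
  exists m n : nat, [/\ (m <= k)%N, (n <= k)%N, t.1 = m%:Z - n%:Z &
                       block S m n t.2].
Proof.
elim: s => [|t s IH] gs; first by exists 0%N.
have [|k H] := IH; first by move=> u us; apply: gs; rewrite inE us orbT.
have [m [n [pE bt]]] := gs t (mem_head _ _).
exists (k + m + n)%N => u; rewrite inE => /orP[/eqP->|/H].
  by exists m, n; split => //; lia.
by move=> [m' [n' [? ? ? ?]]]; exists m', n'; split => //; lia.
Qed.

(** The isometries [rho^(k+i) v] act on a homogeneous element from both sides
    by testing whether its degree is [i - j]. This replaces integration
    against the gauge action. *)
Lemma compressors s N : (1 < #|I|)%N -> graded s -> exists w : nat -> A,
  (forall i j, (i < N)%N -> (j < N)%N -> star (w i) * w j = (i == j)%:R) /\
  (forall t i j, t \in s -> (i < N)%N -> (j < N)%N ->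
     star (w i) * t.2 * w j = (t.1 == i%:Z - j%:Z)%:R *: t.2).
Proof.
move=> I2 /graded_level[k H].
have [v [vv v0]] := shift_isometry (k + N) I2.
exists (fun i => iter (k + i) (rho S) v); split=> [i j iN jN|t i j ts iN jN].
  by rewrite (shift_orth vv v0); [congr (nat_of_bool _)%:R; lia|lia|lia].
have [m [n [mk nk -> bt]]] := H t ts.
by apply: (compress_block vv v0 mk nk _ _ bt); lia.
Qed.

End Graded.

(** * Laurent polynomials and isometric morphisms *)

Lemma int_diff (p : int) : exists i j : nat,
  [/\ (i <= `|p|)%N, (j <= `|p|)%N & p = i%:Z - j%:Z].
Proof.
case: (leP 0 p) => p0; first by exists `|p|%N, 0%N; split; lia.
by exists 0%N, `|p|%N; split; lia.
Qed.

Lemma absz_leD (p q : int) L L' :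
  (`|p| <= L)%N -> (`|q| <= L')%N -> (`|(p + q)%R| <= L + L')%N.
Proof. by lia. Qed.

Lemma absz_shift (p : int) L : (`|p| <= L)%N ->
  exists2 k, (k < L + L.+1)%N & p = k%:Z - L%:Z.
Proof. by move=> pL; exists `|(p + L%:Z)%R|%N; lia. Qed.

Lemma nrm_compress (R : realType) (D : cstarType R) (a b z : D) :
  nrm a = 1 -> nrm b = 1 -> nrm (star a * z * b) <= nrm z.
Proof.
move=> a1 b1; apply: le_trans (nrmM _ _) _; rewrite b1 mulr1.
by apply: le_trans (nrmM _ _) _; rewrite nrm_star a1 mul1r.
Qed.

Section Laurent.
Variables (R : realType) (I : finType) (A : cstarType R) (S : I -> A).
Hypotheses (hS : is_cuntz S) (I2 : (1 < #|I|)%N).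
Implicit Types x y : A.

(** A component is a corner between two isometries; this is why taking it is a
    contraction, both in the algebra and after applying any morphism. *)
Lemma component_compress p (s : seq (int * A)) : graded S s -> exists a b : A,
  [/\ star a * a = 1, star b * b = 1 & component p s = star a * value s * b].
Proof.
move=> gs; have [w [ww wt]] := compressors hS `|p|.+1 I2 gs.
have [i [j [iN jN pE]]] := int_diff p.
exists (w i), (w j); split; [by rewrite ww // eqxx | by rewrite ww // eqxx |].
rewrite mulr_sumr mulr_suml /component big_mkcond /= !big_seq.
apply: eq_bigr => t ts; rewrite wt // -pE.
by case: eqP => _; rewrite ?scale1r ?scale0r.
Qed.

(** The bound [L] on the degrees grows linearly under powers; this is the loss
    that [nrm_le_of_pow] absorbs. *)
Definition laurent L x := exists s,
  [/\ graded S s, forall t, t \in s -> (`|t.1| <= L)%N & x = value s].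

Lemma homog_laurent p x : homog S p x -> laurent `|p| x.
Proof.
move=> hx; exists [:: (p, x)]; split; last by rewrite /value big_seq1.
  by move=> t; rewrite inE => /eqP->.
by move=> t; rewrite inE => /eqP->.
Qed.

Lemma laurentD L L' x y : laurent L x -> laurent L' y -> laurent (L + L') (x + y).
Proof.
move=> [s [gs sL ->]] [s' [gs' sL' ->]]; exists (s ++ s').
split; last by rewrite /value big_cat.
  by move=> t; rewrite mem_cat => /orP[/gs|/gs'].
move=> t; rewrite mem_cat => /orP[/sL|/sL'] /leq_trans; apply.
    exact: leq_addr.
  exact: leq_addl.
Qed.

Definition scale_seq (c : R[i]) (s : seq (int * A)) :=
  [seq (t.1, c *: t.2) | t <- s].

Lemma graded_scale c s : graded S s -> graded S (scale_seq c s).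
Proof. by move=> gs _ /mapP[t ts ->] /=; apply: homogZ; apply: gs. Qed.

Lemma laurentZ L c x : laurent L x -> laurent L (c *: x).
Proof.
move=> [s [gs sL ->]]; exists (scale_seq c s); split.
- exact: graded_scale.
- by move=> _ /mapP[t /sL ts ->].
- by rewrite /value big_map scaler_sumr.
Qed.

Lemma laurentM L L' x y : laurent L x -> laurent L' y -> laurent (L + L') (x * y).
Proof.
move=> [s [gs sL ->]] [s' [gs' sL' ->]].
exists [seq (t.1 + t'.1, t.2 * t'.2) | t <- s, t' <- s']; split.
- move=> _ /allpairsP[[t t'] /= [ts ts' ->]] /=.
  by apply: homogM => //; [apply: gs|apply: gs'].
- move=> _ /allpairsP[[t t'] /= [/sL ts /sL' ts' ->]] /=; exact: absz_leD.
- rewrite /value big_allpairs_dep mulr_suml; apply: eq_bigr => t _.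
  by rewrite mulr_sumr.
Qed.

Lemma laurent_star L x : laurent L x -> laurent L (star x).
Proof.
move=> [s [gs sL ->]]; exists [seq (- t.1, star t.2) | t <- s]; split.
- by move=> _ /mapP[t ts ->] /=; apply: homog_star; apply: gs.
- by move=> _ /mapP[t /sL ts ->] /=; rewrite abszN.
- by rewrite /value big_map star_sum.
Qed.

Lemma laurentX L x n : laurent L x -> laurent (n * L) (x ^+ n).
Proof.
move=> px; elim: n => [|n IH]; last by rewrite exprS mulSn; apply: laurentM.
by rewrite mul0n; apply: (@homog_laurent 0); apply: homog_one.
Qed.

Lemma value_group (g : int -> R[i]) L (s : seq (int * A)) :
  (forall t, t \in s -> g t.1 != 0 -> (`|t.1| <= L)%N) ->
  \sum_(t <- s) g t.1 *: t.2 =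
  \sum_(i < L + L.+1) g (i%:Z - L%:Z) *: component (i%:Z - L%:Z) s.
Proof.
move=> H; under [RHS]eq_bigr => i _ do rewrite /component scaler_sumr big_mkcond /=.
rewrite exchange_big /= !big_seq; apply: eq_bigr => t ts.
have [g0|g0] := eqVneq (g t.1) 0.
  rewrite g0 scale0r big1 // => i _; case: eqP => // <-; by rewrite g0 scale0r.
have tL := H t ts g0.
have [k kP tE] := absz_shift tL.
rewrite tE (bigD1 (Ordinal kP)) //= eqxx big1 ?addr0 // => i ik.
rewrite ifN //; apply: contraNneq ik => E; apply/eqP/val_inj => /=.
by apply/eqP; rewrite -eqz_nat; apply/eqP/(addIr (- L%:Z)).
Qed.

End Laurent.

Section Isometric.
Variables (R : realType) (I : finType) (A B : cstarType R) (S : I -> A).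
Hypotheses (hS : is_cuntz S) (I2 : (1 < #|I|)%N).
Variables (f : {lrmorphism A -> B}).
Hypothesis fs : star_preserving f.
Implicit Types x y : A.

Lemma nrm_morph_isometry x : star x * x = 1 -> nrm (f x) = 1.
Proof. by move=> xx; apply: nrm_isometry; rewrite -fs -rmorphM xx rmorph1. Qed.

Lemma nrm_morph_component p s : graded S s ->
  nrm (f (component p s)) <= nrm (f (value s)).
Proof.
move=> gs; have [a [b [aa bb ->]]] := component_compress hS I2 p gs.
by rewrite !rmorphM /= fs nrm_compress ?nrm_morph_isometry.
Qed.

(** Each of the coefficients of [x] is seen by [f], as [f] maps words to
    isometries. *)
Lemma block_nrm_le n x : block S n n x ->
  nrm x <= (#|{: n.-tuple I}| * #|{: n.-tuple I}|)%:R * nrm (f x).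
Proof.
move=> /(block_expand hS)[c [cE xE]]; rewrite {1}xE.
apply: (@le_trans _ _ (\sum_(mu : n.-tuple I) \sum_(nu : n.-tuple I) nrm (f x)));
  last by rewrite !sumr_const -mulrnA mulr_natl.
apply: le_trans (nrm_sum _ _ _) _; apply: ler_sum => mu _.
apply: le_trans (nrm_sum _ _ _) _; apply: ler_sum => nu _.
apply: (@le_trans _ _ (normc (c mu nu))).
  rewrite nrmZ ler_piMr ?normc_ge0 //; last first.
    apply: le_trans (nrmM _ _) _; rewrite nrm_star.
    by rewrite !nrm_isometry ?mulr1 // word_isometry.
  by rewrite -[normc _](ger0_norm _) //; case: (c mu nu) => a b; rewrite sqrtr_ge0.
have := cE mu nu => /(congr1 f); rewrite linearZ rmorph1 !rmorphM /= fs.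
move=> /(congr1 (@nrm _ _)); rewrite nrmZ nrm1 mulr1 => <-.
by rewrite nrm_compress ?nrm_morph_isometry ?word_isometry.
Qed.

(** If [x] is in the block [(m, n)], the powers of [x^* x] stay in the one
    finite-dimensional algebra of level [n], so that [block_nrm_le] applies to
    them with a constant factor. *)
Lemma homog_nrm_le p x : homog S p x -> nrm x <= nrm (f x).
Proof.
move=> [m [n [_ bx]]].
apply: (nrm_le_of_pow fs (C := (#|{: n.-tuple I}| * #|{: n.-tuple I}|)%:R)
  (L := 0)) => // k.
rewrite mul0r add0r mulr1; apply: block_nrm_le.
have bxx : block S n n (star x * x).
  by apply: (blockM hS _ bx); apply: block_star.
elim: (2 ^ k)%N => [|j IH]; last by rewrite exprS; apply: (blockM hS _ IH).
by rewrite expr0; apply: (@block_raise _ _ _ _ hS n 0 0); apply: block_one.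
Qed.

(** There are at most [2 L + 1] components; [f] is isometric on each of them,
    and they are bounded by the whole. *)
Lemma laurent_nrm_le_mul L x : laurent S L x ->
  nrm x <= (L + L.+1)%:R * nrm (f x).
Proof.
move=> [s [gs sL ->]].
have vE : value s = \sum_(i < L + L.+1) component (i%:Z - L%:Z) s.
  have := @value_group _ _ (fun=> 1) L s; rewrite /value.
  under eq_bigr do rewrite scale1r; move=> -> => [|t /sL //].
  by under eq_bigr do rewrite scale1r.
rewrite {1}vE; apply: (@le_trans _ _ (\sum_(i < L + L.+1) nrm (f (value s))));
  last by rewrite sumr_const card_ord mulr_natl.
apply: le_trans (nrm_sum _ _ _) _; apply: ler_sum => i _.
apply: (@le_trans _ _ (nrm (f (component (i%:Z - L%:Z) s)))).
  apply: (@homog_nrm_le (i%:Z - L%:Z)).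
  rewrite /component big_seq_cond; apply: homog_sum => // t /andP[ts /eqP <-].
  exact: gs.
exact: nrm_morph_component.
Qed.

End Isometric.

(** * Closed range *)

Lemma closure_star_subalgebra (R : realType) (A : cstarType R) (D : set A) :
  star_subalgebra D -> star_subalgebra (closure D).
Proof.
move=> [DZ DM Ds]; split.
- move=> c x y /closure_nrmP hx /closure_nrmP hy; apply/closure_nrmP => e e0.
  have c0 : 0 <= normc c by case: (c) => a b; rewrite sqrtr_ge0.
  have c1 : 0 < normc c + 1 by rewrite ltr_wpDl.
  have [|x' Dx xe] := hx (e / 2 / (normc c + 1)); first by rewrite !divr_gt0.
  have [|y' Dy ye] := hy (e / 2); first by rewrite divr_gt0.
  exists (c *: x' + y'); first exact: DZ.
  rewrite opprD addrACA -scalerBr [e]splitr.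
  apply: le_lt_trans (nrmD _ _) (ler_ltD _ ye).
  rewrite nrmZ; move: xe; rewrite ltr_pdivlMr // => xe.
  by have := nrm_ge0 (x - x'); nra.
- move=> x y /closure_nrmP hx /closure_nrmP hy; apply/closure_nrmP => e e0.
  have x0 := nrm_ge0 x; have y0 := nrm_ge0 y.
  pose d := Num.min 1 (e / (nrm x + nrm y + 1)).
  have d0 : 0 < d by rewrite lt_min ltr01 divr_gt0 //; lra.
  have d1 : d <= 1 by rewrite ge_min lexx.
  have de : d * (nrm x + nrm y + 1) <= e.
    by rewrite -ler_pdivlMr ?ge_min ?lexx ?orbT //; lra.
  have [x' Dx xe] := hx _ d0; have [y' Dy ye] := hy _ d0.
  exists (x' * y'); first exact: DM.
  have -> : x * y - x' * y' = x * (y - y') + (x - x') * y'.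
    by rewrite mulrBr mulrBl addrA subrK.
  apply: le_lt_trans (nrmD _ _) _.
  have A1 := nrmM x (y - y'); have A2 := nrmM (x - x') y'.
  have A3 : nrm y' <= nrm y + nrm (y - y') by rewrite nrm_distC nrm_le_dist.
  have := nrm_ge0 (y - y'); have := nrm_ge0 (x - x'); have := nrm_ge0 y'.
  nra.
- move=> x /closure_nrmP hx; apply/closure_nrmP => e e0.
  have [x' Dx xe] := hx _ e0; exists (star x'); first exact: Ds.
  by rewrite -starB nrm_star.
Qed.

Section Dense.
Variables (R : realType) (I : finType) (A : cstarType R) (S : I -> A).
Hypotheses (hS : is_cuntz S) (I2 : (1 < #|I|)%N).
Implicit Types x y : A.

(** The closure of the Laurent polynomials is a closed star-subalgebra that
    contains the generators. *)
Lemma laurent_dense x (e : R) : 0 < e ->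
  exists L y, laurent S L y /\ nrm (x - y) < e.
Proof.
move=> e0; pose D := [set y | exists L, laurent S L y].
have DA : star_subalgebra D.
  split.
  - move=> c y z [L py] [L' pz]; exists (L + L')%N; apply: laurentD => //.
    exact: laurentZ.
  - by move=> y z [L py] [L' pz]; exists (L + L')%N; apply: laurentM.
  - by move=> y [L py]; exists L; apply: laurent_star.
have := cuntz_generated hS (@closed_closure _ D) (closure_star_subalgebra DA).
move=> cl; have : closure D x.
  rewrite cl // => i; apply: subset_closure; exists 1%N.
  by apply: (@homog_laurent _ _ _ _ 1); apply: homog_gen.
by move=> /closure_nrmP/(_ e e0)[y [L py] xy]; exists L, y.
Qed.

Variables (B : cstarType R) (f : {lrmorphism A -> B}).
Hypothesis fs : star_preserving f.

Lemma laurent_nrm_le L x : laurent S L x -> nrm x <= nrm (f x).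
Proof.
move=> px; apply: (nrm_le_of_pow fs (C := 1) (L := (2 * (2 * L))%:R)) => // k.
rewrite mul1r; have := @laurent_nrm_le_mul _ _ _ _ _ hS I2 f fs _ _
  (laurentX hS (2 ^ k) (laurentM hS (laurent_star px) px)).
by rewrite (_ : (_ + _.+1)%:R = (2 * (2 * L))%:R * (2 ^ k)%:R + 1) //
  -natrM natr1; congr _%:R; nia.
Qed.

(** Together with [nrm_morph] this says that [f] is isometric; it is the
    uniqueness half of Cuntz's theorem. *)
Lemma cuntz_isometric x : nrm x <= nrm (f x).
Proof.
apply/ler_addgt0Pr => e e0.
have [|L [y [py xy]]] := @laurent_dense x (e / 2); first by rewrite divr_gt0.
have py1 := laurent_nrm_le py.
have fy : nrm (f y) <= nrm (f x) + nrm (x - y).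
  rewrite -nrm_distC; apply: le_trans (nrm_le_dist _ (f x)) _.
  by rewrite lerD2l -rmorphB; apply: nrm_morph.
have := nrm_le_dist x y; lra.
Qed.

Lemma cuntz_range_closed : closed (range f).
Proof.
apply/closure_id/seteqP; split; first exact: subset_closure.
move=> z /closure_nrmP hz.
have /choice[u uz] (n : nat) : exists x, nrm (z - f x) < n.+1%:R^-1.
  by have [|_ [x _ <-] H] := hz n.+1%:R^-1; [rewrite invr_gt0|exists x].
have uu m n : nrm (u m - u n) <= m.+1%:R^-1 + n.+1%:R^-1.
  apply: le_trans (cuntz_isometric _) _; rewrite rmorphB.
  apply: le_trans (nrm_dist _ z _) _; apply: lerD; last exact: ltW (uz n).
  by rewrite nrm_distC ltW ?uz.
have [|l ul] := @nrm_complete _ _ u.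
  move=> e e0; have [|N HN] := @inv_small R (e / 2); first by rewrite divr_gt0.
  exists N => m n Nm Nn; apply: le_lt_trans (uu _ _) _.
  by rewrite [e]splitr ltrD // HN.
exists l => //; apply/eqP; rewrite -subr_eq0; apply/eqP/nrm_eq0_of_le => e e0.
have [|N HN] := ul (e / 2); first by rewrite divr_gt0.
have [|N' HN'] := @inv_small R (e / 2); first by rewrite divr_gt0.
have {}HN := HN (N + N')%N (leq_addr _ _).
have {}HN' := HN' (N + N')%N (leq_addl _ _).
apply: le_trans (nrm_dist _ (f (u (N + N')%N)) _) _.
rewrite -rmorphB [e]splitr lerD //; last by rewrite ltW // (lt_trans _ HN') // nrm_distC.
by apply: le_trans (nrm_morph fs _) _; rewrite nrm_distC ltW.
Qed.

End Dense.

(** * Components of arbitrary elements and Fejer means *)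

(** The unnormalised Fejer kernel counts the pairs of indices with a given
    difference. *)
Lemma sum_diff N (p : int) :
  (\sum_(i < N) \sum_(j < N) (p == (i%:Z - j%:Z)%R) = N - `|p|)%N.
Proof.
have H k : (\sum_(i < N) \sum_(j < N) (i == j + k :> nat) = N - k)%N.
  rewrite exchange_big /=.
  transitivity (\sum_(j < N) (j < N - k) : nat)%N; last first.
    suff : forall M, (\sum_(j < N) (j < M) = minn N M)%N by move=> ->; lia.
    by move=> M; elim: N => [|N IH]; rewrite ?big_ord0 ?big_ord_recr /= ?IH; lia.
  apply: eq_bigr => j _; case: ltnP => jk.
    have jkN : (j + k < N)%N by lia.
    rewrite (bigD1 (Ordinal jkN)) //= eqxx big1 ?addn0 // => i ik.
    by apply/eqP; rewrite eqb0; apply: contraNneq ik => E; apply/eqP/val_inj.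
  by rewrite big1 // => i _; have := ltn_ord i; lia.
case: (leP 0 p) => p0.
  rewrite -H; apply: eq_bigr => i _; apply: eq_bigr => j _; congr nat_of_bool; lia.
rewrite -H exchange_big; apply: eq_bigr => i _; apply: eq_bigr => j _ /=.
congr nat_of_bool; lia.
Qed.

Section Fejer.
Variables (R : realType) (I : finType) (A : cstarType R) (S : I -> A).
Hypotheses (hS : is_cuntz S) (I2 : (1 < #|I|)%N).
Implicit Types x y : A.
Implicit Types s : seq (int * A).

Definition sub_seq s s' := s ++ scale_seq (-1) s'.

Lemma graded_sub s s' : graded S s -> graded S s' -> graded S (sub_seq s s').
Proof.
move=> gs gs' t; rewrite mem_cat => /orP[/gs//|]; exact: (graded_scale gs').
Qed.

Lemma component_sub p s s' :
  component p (sub_seq s s') = component p s - component p s'.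
Proof.
rewrite /component big_cat /= big_map /= -sumrN; congr (_ + _).
by apply: eq_bigr => t _; rewrite scaleN1r.
Qed.

Lemma sum_sub (g : int -> R[i]) s s' : \sum_(t <- sub_seq s s') g t.1 *: t.2 =
  \sum_(t <- s) g t.1 *: t.2 - \sum_(t <- s') g t.1 *: t.2.
Proof.
rewrite big_cat /= big_map /= -sumrN; congr (_ + _); apply: eq_bigr => t _.
by rewrite scaleN1r scalerN.
Qed.

Lemma value_sub s s' : value (sub_seq s s') = value s - value s'.
Proof.
rewrite /value big_cat /= big_map /= -sumrN; congr (_ + _); apply: eq_bigr => t _.
by rewrite scaleN1r.
Qed.

Lemma nrm_component p s : graded S s -> nrm (component p s) <= nrm (value s).
Proof.
move=> gs; have [a [b [aa bb ->]]] := component_compress hS I2 p gs.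
by rewrite nrm_compress ?nrm_isometry.
Qed.

Lemma graded_dense x (e : R) : 0 < e ->
  exists2 s, graded S s & nrm (x - value s) < e.
Proof.
move=> e0; have [L [y [[s [gs _ ->]] xs]]] := laurent_dense hS x e0.
by exists s.
Qed.

(** [e p] is the component of degree [p] of [x]. As Laurent polynomials are
    dense, the estimate determines [e]; it also says that [e] extends
    [component]. *)
Definition is_coefs x (e : int -> A) := forall p s, graded S s ->
  nrm (e p - component p s) <= nrm (x - value s).

(** By [nrm_component], the components of a sequence of Laurent polynomials
    that converges to [x] form a Cauchy sequence. *)
Lemma coefs_exist x : exists e, is_coefs x e.
Proof.
suff H p : exists a, forall s, graded S s ->
    nrm (a - component p s) <= nrm (x - value s).
  have [e He] := choice H; exists e => p s; exact: He.
have /choice[u uP] (n : nat) : exists s, graded S s /\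
    nrm (x - value s) < n.+1%:R^-1.
  have [|s gs xs] := @graded_dense x n.+1%:R^-1; first by rewrite invr_gt0.
  by exists s.
have cd s s' : graded S s -> graded S s' ->
    nrm (component p s - component p s') <= nrm (x - value s) + nrm (x - value s').
  move=> gs gs'; rewrite -component_sub.
  apply: le_trans (nrm_component _ (graded_sub gs gs')) _.
  by rewrite value_sub (le_trans (nrm_dist _ x _)) // lerD // nrm_distC.
have [|l ul] := @nrm_complete _ _ (fun n => component p (u n)).
  move=> e e0; have [|N HN] := @inv_small R (e / 2); first by rewrite divr_gt0.
  exists N => m n Nm Nn.
  have [gm xm] := uP m; have [gn xn] := uP n.
  apply: le_lt_trans (cd _ _ gm gn) _; rewrite [e]splitr.
  by apply: ltrD; [exact: lt_trans xm (HN _ Nm)|exact: lt_trans xn (HN _ Nn)].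
exists l => s gs; apply/ler_addgt0Pr => e e0.
have [|N HN] := ul (e / 2); first by rewrite divr_gt0.
have [|N' HN'] := @inv_small R (e / 2); first by rewrite divr_gt0.
have {}HN := HN (N + N')%N (leq_addr _ _).
have {}HN' := HN' (N + N')%N (leq_addl _ _).
have [gn xn] := uP (N + N')%N.
apply: le_trans (nrm_dist _ (component p (u (N + N')%N)) _) _.
have {}xn := lt_trans xn HN'.
by have := cd _ _ gn gs; move: HN => /=; rewrite nrm_distC; lra.
Qed.

(** With [W = w_0 + ... + w_(N-1)], an element of degree [p] satisfies [W^* x
    W = (N - |p|) x], because [N - |p|] pairs of indices have difference [p],
    and [W / sqrt N] is an isometry. *)
Lemma nrm_fejer N s : graded S s ->
  nrm (\sum_(t <- s) (N - `|t.1|)%:R *: t.2) <= N%:R * nrm (value s).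
Proof.
move=> gs; have [w [ww wt]] := compressors hS N I2 gs.
pose W := \sum_(i < N) w i.
have WW : star W * W = N%:R.
  rewrite star_sum mulr_suml -[N in RHS]card_ord -sum1_card natr_sum.
  apply: eq_bigr => i _; rewrite mulr_sumr (bigD1 i) //= ww // eqxx.
  rewrite big1 ?addr0 // => j ji; rewrite ww //.
  by rewrite (negPf (_ : (i != j :> nat))) // eq_sym.
have W2 : nrm W ^+ 2 = N%:R.
  by rewrite -nrm_cstar WW -scaler_nat nrmZ nrm1 mulr1 normc_nat.
have -> : \sum_(t <- s) (N - `|t.1|)%:R *: t.2 = star W * value s * W.
  rewrite [star W * _]mulr_sumr mulr_suml !big_seq; apply: eq_bigr => t ts.
  rewrite -sum_diff natr_sum scaler_suml star_sum !mulr_suml.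
  apply: eq_bigr => i _; rewrite natr_sum scaler_suml mulr_sumr.
  by apply: eq_bigr => j _; rewrite wt.
apply: le_trans (nrmM _ _) _; apply: (@le_trans _ _ (nrm W * nrm (value s) * nrm W)).
  rewrite ler_wpM2r ?nrm_ge0 //; apply: le_trans (nrmM _ _) _.
  by rewrite nrm_star.
by rewrite mulrAC -expr2 W2.
Qed.

End Fejer.

Lemma nrm_natB (R : realType) (A : cstarType R) k l :
  nrm (k%:R - l%:R : A) = `|k%:R - l%:R|.
Proof.
have E j : j%:R = (j%:R : R[i])%:A :> A by rewrite scaler_nat.
rewrite !E -scalerBl nrmZ nrm1 mulr1 -!(rmorph_nat (real_complex R)) -rmorphB /=.
by rewrite /normc /= expr0n /= addr0 sqrtr_sqr.
Qed.

Section Concentration.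
Variables (R : realType) (I : finType) (A : cstarType R) (S : I -> A).
Hypotheses (hS : is_cuntz S) (I2 : (1 < #|I|)%N).
Implicit Types x y : A.
Implicit Types s : seq (int * A).

Definition fejer N (p : int) : R[i] := (N%:R)^-1 * (N - `|p|)%:R.

Definition fejer_mean N s := \sum_(t <- s) fejer N t.1 *: t.2.

Lemma nrm_fejer_mean N s : (0 < N)%N -> graded S s ->
  nrm (fejer_mean N s) <= nrm (value s).
Proof.
move=> N0 gs; rewrite /fejer_mean.
under eq_bigr do rewrite -scalerA.
rewrite -scaler_sumr nrmZ normcVn ler_pdivrMl ?ltr0n //.
exact: nrm_fejer gs.
Qed.

(** The Fejer coefficient of degree [p] differs from 1 by at most [|p| /
    N]. *)
Lemma fejer_mean_cvg s (e : R) : 0 < e ->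
  exists2 N, (0 < N)%N & nrm (fejer_mean N s - value s) <= e.
Proof.
move=> e0; pose b := \sum_(t <- s) `|t.1|%:R * nrm t.2 : R.
have b0 : 0 <= b by apply: sumr_ge0 => t _; rewrite mulr_ge0 ?nrm_ge0.
have [M HM] := @inv_small R (e / (b + 1)) (divr_gt0 e0 (ltr_wpDl b0 ltr01)).
have {}HM := HM M (leqnn _); exists M.+1 => //; set N := M.+1.
have N0 : 0 < N%:R :> R by rewrite ltr0n.
apply: (@le_trans _ _ (N%:R^-1 * b)); last first.
  rewrite ler_pdivrMl //; move: HM; rewrite -/N ltr_pdivlMr; last lra.
  rewrite mulrC ltr_pdivrMr // => H; nra.
rewrite /fejer_mean /value -sumrB mulr_sumr; apply: le_trans (nrm_sum _ _ _) _.
apply: ler_sum => t _; rewrite -{2}[t.2]scale1r -scalerBl nrmZ mulrA.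
rewrite ler_wpM2r ?nrm_ge0 //.
have -> : fejer N t.1 - 1 = - (N%:R^-1 * (minn N `|t.1|)%:R).
  have NN : (N%:R : R[i]) != 0 by rewrite pnatr_eq0.
  rewrite -{1}(mulVf NN) /fejer -mulrBr -mulrN; congr (_ * _).
  rewrite -opprB; congr (- _); by rewrite -natrB ?leq_subr // -minnE.
rewrite normcN normcM normcVn normc_nat ler_wpM2l ?invr_ge0 ?(ltW N0) //.
by rewrite ler_nat geq_minr.
Qed.

(** An element all of whose components outside degree [q] vanish is a limit of
    elements of degree [q]. The Fejer mean of order [N] of a good
    approximation [s] of [x] is near [x]; it involves fewer than [2 N + 1]
    components, and those of degree other than [q] are as small as the error
    of [s]. *)
Lemma coefs_concentrated x q (c : int -> A) : is_coefs S x c ->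
  (forall p, p != q -> c p = 0) ->
  forall e : R, 0 < e -> exists2 y, homog S q y & nrm (x - y) < e.
Proof.
move=> cx c0 e e0; pose d := e / 6.
have d0 : 0 < d by rewrite divr_gt0.
have [s0 gs0 xs0] := graded_dense hS x d0.
have [N N0 HN] := fejer_mean_cvg s0 d0.
pose K := (N + N.+1)%N.
have K0 : 0 < K%:R :> R by rewrite ltr0n /K; lia.
have [s gs xs] := graded_dense hS x (divr_gt0 d0 K0).
have xsd : nrm (x - value s) < d.
  by apply: lt_le_trans xs _; rewrite ler_pdivrMr // ler_peMr ?(ltW d0) // ler1n /K; lia.
(* The order [N] depends only on the first approximation [s0]; the second one
   is chosen so close to [x] that [K] error terms together are at most [d]. *)
exists (fejer N q *: component q s).
  apply: homogZ; rewrite /component big_seq_cond; apply: homog_sum => // t.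
  by move=> /andP[ts /eqP<-]; apply: gs.
have H1 : nrm (fejer_mean N s0 - fejer_mean N s) <= d + d.
  rewrite -sum_sub; apply: le_trans (nrm_fejer_mean N0 (graded_sub gs0 gs)) _.
  rewrite value_sub; apply: le_trans (nrm_dist _ x _) _.
  by rewrite lerD ?ltW // nrm_distC.
have H2 : nrm (fejer_mean N s - fejer N q *: component q s) <= d.
  pose g p := if p == q then 0 else fejer N p.
  have -> : fejer_mean N s - fejer N q *: component q s = \sum_(t <- s) g t.1 *: t.2.
    rewrite /component scaler_sumr big_mkcond -sumrB; apply: eq_bigr => t _.
    by rewrite /g; case: eqP => [->|_]; rewrite ?subrr ?scale0r ?subr0.
  rewrite (value_group (L := N)) => [|t _]; last first.
    rewrite /g; case: ifP; first by rewrite eqxx.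
    rewrite /fejer mulf_eq0 negb_or => _ /andP[_].
    by rewrite pnatr_eq0 subn_eq0 -ltnNge => /ltnW.
  apply: (@le_trans _ _ (\sum_(i < K) d / K%:R)); last first.
    by rewrite sumr_const card_ord -[leLHS]mulr_natr divfK // gt_eqF.
  apply: le_trans (nrm_sum _ _ _) _; apply: ler_sum => i _; rewrite /g.
  case: eqP => [_|/eqP iq].
    by rewrite scale0r nrm0 divr_ge0 // ltW.
  rewrite nrmZ; apply: (@le_trans _ _ (nrm (component (i%:Z - N%:Z) s))).
      rewrite ler_piMl ?nrm_ge0 // normcM normcVn normc_nat ler_pdivrMl ?ltr0n //.
      by rewrite mulr1 ler_nat leq_subr.
  have := cx (i%:Z - N%:Z) s gs; rewrite c0 // sub0r nrmN => /le_trans; apply.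
  exact: ltW.
have H3 := nrm_dist x (value s0) (fejer N q *: component q s).
have H4 := nrm_dist (value s0) (fejer_mean N s0) (fejer N q *: component q s).
have H5 := nrm_dist (fejer_mean N s0) (fejer_mean N s) (fejer N q *: component q s).
rewrite nrm_distC in HN.
have : d * 6 = e by rewrite divfK.
lra.
Qed.

Lemma closure_homog0 x : (forall e : R, 0 < e ->
  exists2 y, homog S 0 y & nrm (x - y) < e) -> Fd S x.
Proof.
move=> H; apply/closure_nrmP => e e0; have [y [m [n [mn by_]]] xy] := H e e0.
exists y => //; exists n => //; apply/Fn_block => //.
move/eqP: mn; rewrite eq_sym subr_eq0 eqz_nat => /eqP E.
by move: by_; rewrite E.
Qed.

(** * Homogeneous unitaries have degree zero *)

(** On the matrix algebra spanned by [S_mu S_nu^*] with [|mu| = |nu| = n] this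
    is the trace, times the unit. *)
Definition word_trace n x :=
  \sum_(mu : n.-tuple I) star (word S mu) * x * word S mu.

Lemma nrm_word_trace_dist n x :
  nrm (word_trace n x - (#|I| ^ n)%:R) <= (#|I| ^ n)%:R * nrm (x - 1).
Proof.
have -> : word_trace n x - (#|I| ^ n)%:R =
    \sum_(mu : n.-tuple I) star (word S mu) * (x - 1) * word S mu.
  rewrite -card_tuple -sum1_card natr_sum -sumrB; apply: eq_bigr => mu _.
  by rewrite mulrBr mulrBl mulr1 word_isometry.
apply: (@le_trans _ _ (\sum_(mu : n.-tuple I) nrm (x - 1))); last first.
  by rewrite sumr_const card_tuple mulr_natl.
apply: le_trans (nrm_sum _ _ _) _; apply: ler_sum => mu _.
by rewrite nrm_compress ?nrm_isometry ?word_isometry.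
Qed.

(** Both sides are the sum of the squared moduli of the coefficients of
    [x]. *)
Lemma word_trace_comm m n x : block S m n x ->
  word_trace n (star x * x) = word_trace m (x * star x).
Proof.
move=> bx; have [c [cE _]] := block_expand hS bx.
have cE' (mu : m.-tuple I) (nu : n.-tuple I) :
    star (word S nu) * star x * word S mu = (Num.conj (c mu nu))%:A.
  by rewrite -[1 in RHS]star1 -starZ -cE !starM starK mulrA.
transitivity (\sum_(nu : n.-tuple I) \sum_(mu : m.-tuple I)
    (star (word S nu) * star x * word S mu) * (star (word S mu) * x * word S nu)).
  apply: eq_bigr => nu _.
  transitivity (star (word S nu) * star x * 1 * (x * word S nu)).
    by rewrite mulr1 !mulrA.
  rewrite -(word_sum hS m) mulr_sumr mulr_suml; apply: eq_bigr => mu _.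
  by rewrite !mulrA.
rewrite exchange_big; apply: eq_bigr => mu _.
transitivity (star (word S mu) * x * 1 * (star x * word S mu)); last first.
  by rewrite mulr1 !mulrA.
rewrite -(word_sum hS n) mulr_sumr mulr_suml; apply: eq_bigr => nu _.
transitivity ((star (word S mu) * x * word S nu) *
  (star (word S nu) * star x * word S mu)); last by rewrite !mulrA.
by rewrite cE cE' -!scalerAl !mul1r !scalerA mulrC.
Qed.

(** If [x] in the block [(m, n)] is near a unitary, then [x^* x] and [x x^*]
    are near 1, so their traces are near [d ^ n] and [d ^ m]; but these traces
    are equal. The tolerance [1 / 12] makes both products differ from 1 by at
    most [1 / 4], whereas unequal powers of [d >= 2] differ by at least a
    third of their sum. *)
Lemma unitary_degree v p : unitary_elt v ->
  (forall e : R, 0 < e -> exists2 y, homog S p y & nrm (v - y) < e) -> p = 0.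
Proof.
move=> [vv vv'] H.
have [|x [m [n [pE bx]]] vx] := H (1 / 12); first by rewrite divr_gt0.
have v1 : nrm v = 1 by apply: nrm_isometry.
have x2 : nrm x <= 13 / 12.
  by apply: le_trans (nrm_le_dist _ v) _; rewrite v1 nrm_distC; lra.
have xx1 : nrm (star x * x - 1) <= 1 / 4.
  have -> : star x * x - 1 = star x * (x - v) + star (x - v) * v.
    by rewrite starB mulrBr mulrBl vv addrA subrK.
  apply: le_trans (nrmD _ _) _.
  have := nrmM (star x) (x - v); have := nrmM (star (x - v)) v.
  rewrite !nrm_star v1 nrm_distC; have := nrm_ge0 (v - x); have := nrm_ge0 x; nra.
have xx2 : nrm (x * star x - 1) <= 1 / 4.
  have -> : x * star x - 1 = x * star (x - v) + (x - v) * star v.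
    by rewrite starB mulrBr mulrBl vv' addrA subrK.
  apply: le_trans (nrmD _ _) _.
  have := nrmM x (star (x - v)); have := nrmM (x - v) (star v).
  rewrite !nrm_star v1 nrm_distC; have := nrm_ge0 (v - x); have := nrm_ge0 x; nra.
have T1 := nrm_word_trace_dist n (star x * x).
have T2 := nrm_word_trace_dist m (x * star x).
rewrite -(word_trace_comm bx) in T2.
set a : R := (#|I| ^ n)%:R in T1; set b : R := (#|I| ^ m)%:R in T2.
have ab : `|a - b| <= (a + b) / 4.
  rewrite -(nrm_natB A); set z := word_trace n _ in T1 T2.
  apply: le_trans (nrm_dist _ z _) _; rewrite nrm_distC mulrDl.
  apply: lerD; [apply: le_trans T1 _|apply: le_trans T2 _];
  by rewrite -(div1r 4) ler_wpM2l ?ler0n.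
suff : m = n by lia.
have pow k l : (k < l)%N -> (2 * #|I| ^ k <= #|I| ^ l)%N.
  move=> kl; rewrite -(subnKC kl) addSn expnS expnD mulnA.
  apply: (@leq_trans (#|I| * #|I| ^ k)); first by rewrite leq_mul2r I2 orbT.
  by rewrite leq_pmulr // expn_gt0 (ltnW I2).
have a1 : 1 <= a by rewrite ler1n expn_gt0 (ltnW I2).
have b1 : 1 <= b by rewrite ler1n expn_gt0 (ltnW I2).
move: ab; rewrite ler_norml => /andP[ab1 ab2].
case: (ltngtP m n) => // /pow; rewrite -(ler_nat R) natrM -/a -/b => le;
  exfalso; clear - le a1 b1 ab1 ab2.
  by lra.
by lra.
Qed.

End Concentration.

(** * Tensor products *)

Section TensorNorm.
Variables (R : realType) (A B T : cstarType R) (tens : A -> B -> T).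
Hypothesis htens : is_cstar_tensor tens.

Lemma tensDl a a' b : tens (a + a') b = tens a b + tens a' b.
Proof. by have := tens_linl htens b 1 a a'; rewrite !scale1r. Qed.

Lemma tensDr a b b' : tens a (b + b') = tens a b + tens a b'.
Proof. by have := tens_linr htens a 1 b b'; rewrite !scale1r. Qed.

Lemma tens0l b : tens 0 b = 0.
Proof. by apply: (@addIr _ (tens 0 b)); rewrite -tensDl !add0r. Qed.

Lemma tens0r a : tens a 0 = 0.
Proof. by apply: (@addIr _ (tens a 0)); rewrite -tensDr !add0r. Qed.

Lemma tensZl c a b : tens (c *: a) b = c *: tens a b.
Proof. by have := tens_linl htens b c a 0; rewrite !addr0 tens0l addr0. Qed.

Lemma tensZr c a b : tens a (c *: b) = c *: tens a b.
Proof. by have := tens_linr htens a c b 0; rewrite !addr0 tens0r addr0. Qed.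

Lemma tensBl a a' b : tens (a - a') b = tens a b - tens a' b.
Proof. by rewrite -scaleN1r tensDl tensZl scaleN1r. Qed.

Lemma tensBr a b b' : tens a (b - b') = tens a b - tens a b'.
Proof. by rewrite -scaleN1r tensDr tensZr scaleN1r. Qed.

Lemma tens_suml (K : Type) (r : seq K) (P : pred K) (F : K -> A) b :
  tens (\sum_(k <- r | P k) F k) b = \sum_(k <- r | P k) tens (F k) b.
Proof.
exact: (big_morph (fun a => tens a b) (fun a a' => tensDl a a' b) (tens0l b)).
Qed.

Lemma tens_sumr (K : Type) (r : seq K) (P : pred K) (F : K -> B) a :
  tens a (\sum_(k <- r | P k) F k) = \sum_(k <- r | P k) tens a (F k).
Proof. exact: (big_morph (tens a) (tensDr a) (tens0r a)). Qed.

Lemma nrm_tens_leg1 a : nrm (tens a 1) <= nrm a.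
Proof.
have [||| g gE] := @lrmorphism_of _ A T (fun a => tens a 1).
- by move=> c x y; rewrite tensDl tensZl.
- by move=> x y; rewrite (tensM htens) mulr1.
- exact: tens1 htens.
rewrite -gE; apply: nrm_morph => x.
by rewrite !gE (tens_star htens) star1.
Qed.

Lemma nrm_tens_leg2 b : nrm (tens 1 b) <= nrm b.
Proof.
have [||| g gE] := @lrmorphism_of _ B T (tens 1).
- by move=> c x y; rewrite tensDr tensZr.
- by move=> x y; rewrite (tensM htens) mulr1.
- exact: tens1 htens.
rewrite -gE; apply: nrm_morph => x.
by rewrite !gE (tens_star htens) star1.
Qed.

(** The maps [a |-> tens a 1] and [b |-> tens 1 b] are star-preserving
    morphisms, hence contractions. *)
Lemma nrm_tens a b : nrm (tens a b) <= nrm a * nrm b.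
Proof.
rewrite -[a in tens a]mulr1 -[b in tens _ b]mul1r -(tensM htens).
apply: le_trans (nrmM _ _) _.
by rewrite ler_pM ?nrm_ge0 ?nrm_tens_leg1 ?nrm_tens_leg2.
Qed.

Lemma tens_isometry a b : star a * a = 1 -> star b * b = 1 ->
  star (tens a b) * tens a b = 1.
Proof. by move=> aa bb; rewrite (tens_star htens) (tensM htens) aa bb (tens1 htens). Qed.

(** A nonzero [a] is linearly independent. *)
Lemma tens_eq0 a b : tens a b = 0 -> a = 0 \/ b = 0.
Proof.
move=> ab; have [->|a0] := eqVneq a 0; [by left|right].
apply: (tens_inj htens (n := 1) (a := fun=> a) (b := fun=> b)) ord0.
  move=> c; rewrite big_ord1 => /eqP; rewrite scaler_eq0 (negPf a0) orbF.
  by move=> /eqP c0 k; rewrite ord1.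
by rewrite big_ord1.
Qed.
End TensorNorm.

(** * Bidegrees in the tensor product *)

Section Bidegree.
Variables (R : realType) (I J : finType) (A B C T : cstarType R).
Variables (S : I -> A) (St : J -> B) (U : I * J -> C).
Variables (tens : A -> B -> T) (iota : {lrmorphism C -> T}).
Hypotheses (I2 : (1 < #|I|)%N) (J2 : (1 < #|J|)%N).
Hypotheses (hS : is_cuntz S) (hSt : is_cuntz St) (hU : is_cuntz U).
Hypotheses (htens : is_cstar_tensor tens) (iota_star : star_preserving iota).
Hypothesis iotaU : forall i j, iota (U (i, j)) = tens (S i) (St j).

Lemma card_prod_gt1 : (1 < #|{: I * J}|)%N.
Proof. by rewrite card_prod; nia. Qed.

Lemma iota_word (mu : seq (I * J)) :
  iota (word U mu) = tens (word S (map fst mu)) (word St (map snd mu)).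
Proof.
elim: mu => [|[i j] mu IH]; first by rewrite !word_nil rmorph1 (tens1 htens).
by rewrite !word_cons rmorphM /= IH iotaU (tensM htens).
Qed.

Lemma iota_word2 (mu nu : seq (I * J)) :
  iota (word U mu * star (word U nu)) =
  tens (word S (map fst mu) * star (word S (map fst nu)))
       (word St (map snd mu) * star (word St (map snd nu))).
Proof. by rewrite rmorphM /= iota_star !iota_word (tens_star htens) (tensM htens). Qed.

Definition balanced (r : seq (int * (A * B))) := forall t, t \in r ->
  homog S t.1 t.2.1 /\ homog St t.1 t.2.2.

(** The elements of the algebraic tensor product that only have parts of
    bidegree [(p, p)]. *)
Definition diagonal z :=
  exists2 r, balanced r & z = \sum_(t <- r) tens t.2.1 t.2.2.

Lemma diagonal0 : diagonal 0.
Proof. by exists [::]; rewrite ?big_nil. Qed.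

Lemma diagonalD y z : diagonal y -> diagonal z -> diagonal (y + z).
Proof.
move=> [r br ->] [r' br' ->]; exists (r ++ r'); last by rewrite big_cat.
by move=> t; rewrite mem_cat => /orP[/br|/br'].
Qed.

Lemma diagonal_sum (K : Type) (r : seq K) (P : pred K) (F : K -> T) :
  (forall k, P k -> diagonal (F k)) -> diagonal (\sum_(k <- r | P k) F k).
Proof. by move=> H; elim/big_ind: _ => //; [exact: diagonal0|exact: diagonalD]. Qed.

Lemma iota_homog p x : homog U p x -> diagonal (iota x).
Proof.
move=> [m [n [_ /(block_expand hU)[c [_ ->]]]]].
rewrite rmorph_sum /=; apply: diagonal_sum => mu _.
rewrite rmorph_sum /=; apply: diagonal_sum => nu _.
rewrite linearZ /= iota_word2 -tensZl //.
set a := c mu nu *: _; set b := _ * _; exists [:: (m%:Z - n%:Z, (a, b))]; last first.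
  by rewrite big_seq1.
move=> t; rewrite inE => /eqP -> /=; split; exists m, n; split => //.
  apply: blockZ.
  have := @block_word _ _ _ _ hS (map fst mu) (map fst nu).
  by rewrite !size_map !size_tuple.
have := @block_word _ _ _ _ hSt (map snd mu) (map snd nu).
by rewrite !size_map !size_tuple.
Qed.

(** Tensor products of compressors of the two legs cut out the part of
    bidegree [(p, q)], and [z] has no such part. *)
Lemma nrm_offdiagonal p q s st z : p != q -> graded S s -> graded St st ->
  diagonal z ->
  nrm (tens (component p s) (component q st)) <=
  nrm (tens (value s) (value st) - z).
Proof.
move=> pq gs gst [r br ->].
(* The legs of [z] are added to the two lists so that the same compressors act
   on them. *)
have [|w [ww wt]] := @compressors _ _ _ _ hS (s ++ [seq (t.1, t.2.1) | t <- r])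
  `|p|.+1 I2.
  move=> t; rewrite mem_cat => /orP[/gs //|/mapP[t' /br[? ?] ->]] //.
have [|v [vv vt]] := @compressors _ _ _ _ hSt (st ++ [seq (t.1, t.2.2) | t <- r])
  `|q|.+1 J2.
  move=> t; rewrite mem_cat => /orP[/gst //|/mapP[t' /br[? ?] ->]] //.
have [i [j [iN jN pE]]] := int_diff p.
have [k [l [kN lN qE]]] := int_diff q.
have ws t : t \in s ++ [seq (t.1, t.2.1) | t <- r] ->
  star (w i) * t.2 * w j = (t.1 == p)%:R *: t.2 by move=> ts; rewrite wt // -pE.
have vs t : t \in st ++ [seq (t.1, t.2.2) | t <- r] ->
  star (v k) * t.2 * v l = (t.1 == q)%:R *: t.2 by move=> ts; rewrite vt // -qE.
have E1 : star (w i) * value s * w j = component p s.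
  rewrite mulr_sumr mulr_suml /component [RHS]big_mkcond /= !big_seq.
  apply: eq_bigr => t ts; rewrite ws ?mem_cat ?ts //.
  by case: eqP; rewrite ?scale1r ?scale0r.
have E2 : star (v k) * value st * v l = component q st.
  rewrite mulr_sumr mulr_suml /component [RHS]big_mkcond /= !big_seq.
  apply: eq_bigr => t ts; rewrite vs ?mem_cat ?ts //.
  by case: eqP; rewrite ?scale1r ?scale0r.
have E3 : star (tens (w i) (v k)) * (\sum_(t <- r) tens t.2.1 t.2.2) *
    tens (w j) (v l) = 0.
  rewrite mulr_sumr mulr_suml big_seq big1 // => t tr.
  rewrite (tens_star htens) !(tensM htens).
  have tw : (t.1, t.2.1) \in s ++ [seq (t.1, t.2.1) | t <- r].
    by rewrite mem_cat; apply/orP; right; apply/mapP; exists t.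
  have tv : (t.1, t.2.2) \in st ++ [seq (t.1, t.2.2) | t <- r].
    by rewrite mem_cat; apply/orP; right; apply/mapP; exists t.
  have /= -> := ws _ tw; have /= -> := vs _ tv.
  have [->|_] := eqVneq t.1 p; last by rewrite scale0r tens0l.
  by rewrite (negPf pq) scale0r tens0r.
have <- : star (tens (w i) (v k)) * (tens (value s) (value st) -
    \sum_(t <- r) tens t.2.1 t.2.2) * tens (w j) (v l) =
    tens (component p s) (component q st).
  by rewrite mulrBr mulrBl E3 subr0 (tens_star htens) !(tensM htens) E1 E2.
by apply: nrm_compress; apply/nrm_isometry/tens_isometry => //;
  rewrite ?ww ?vv ?eqxx.
Qed.

End Bidegree.

Section Necessity.
Variables (R : realType) (I J : finType) (A B C T : cstarType R).
Variables (S : I -> A) (St : J -> B) (U : I * J -> C).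
Variables (tens : A -> B -> T) (iota : {lrmorphism C -> T}).
Hypotheses (I2 : (1 < #|I|)%N) (J2 : (1 < #|J|)%N).
Hypotheses (hS : is_cuntz S) (hSt : is_cuntz St) (hU : is_cuntz U).
Hypotheses (htens : is_cstar_tensor tens) (iota_star : star_preserving iota).
Hypothesis iotaU : forall i j, iota (U (i, j)) = tens (S i) (St j).

(** Approximate [u], [ut] and the preimage [x] of [tens u ut] by Laurent
    polynomials. The image of the last one is diagonal, so [nrm_offdiagonal]
    bounds the components of the first two by the error of approximation. *)
Lemma tens_coefs_eq0 u ut c ct p q : range iota (tens u ut) ->
  is_coefs S u c -> is_coefs St ut ct -> p != q -> tens (c p) (ct q) = 0.
Proof.
move=> [x _ xE] cu cut pq; apply: nrm_eq0_of_le => e e0.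
(* The total error comes out as at most [d * M] when all approximations are
   within [d <= 1]. *)
pose M := nrm (c p) + nrm (ct q) + nrm u + nrm ut + 3.
have [[[n1 n2] n3] n4] := (nrm_ge0 (c p), nrm_ge0 (ct q), nrm_ge0 u, nrm_ge0 ut).
have M0 : 0 < M by rewrite /M; lra.
pose d := Num.min 1 (e / M).
have d0 : 0 < d by rewrite lt_min ltr01 divr_gt0.
have d1 : d <= 1 by rewrite ge_min lexx.
have de : d * M <= e by rewrite -ler_pdivlMr // ge_min lexx orbT.
have [s gs us] := graded_dense hS u d0.
have [st gst uts] := graded_dense hSt ut d0.
have [L [y [py xy]]] := laurent_dense hU x d0.
have dy : diagonal S St tens (iota y).
  have [r [gr _ ->]] := py; rewrite /value big_seq rmorph_sum /=.
  apply: diagonal_sum => t tr.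
  exact: (iota_homog hS hSt hU htens iota_star iotaU (gr t tr)).
have H1 := nrm_offdiagonal I2 J2 hS hSt htens pq gs gst dy.
have H2 : nrm (c p - component p s) <= d := le_trans (cu p s gs) (ltW us).
have H3 : nrm (ct q - component q st) <= d := le_trans (cut q st gst) (ltW uts).
have H4 : nrm (tens (c p) (ct q)) <=
    d * nrm (ct q) + (nrm (c p) + d) * d +
    nrm (tens (component p s) (component q st)).
  have -> : tens (c p) (ct q) = tens (c p - component p s) (ct q) +
      tens (component p s) (ct q - component q st) +
      tens (component p s) (component q st).
    by rewrite (tensBl htens) (tensBr htens) addrA subrK subrK.
  apply: le_trans (nrmD _ _) _; rewrite lerD2r.
  apply: le_trans (nrmD _ _) _; apply: lerD.
    by apply: le_trans (nrm_tens htens _ _) _; rewrite ler_wpM2r ?nrm_ge0.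
  apply: le_trans (nrm_tens htens _ _) _; rewrite ler_pM ?nrm_ge0 //.
  apply: le_trans (nrm_le_dist _ (c p)) _; rewrite lerD2l.
  by rewrite nrm_distC.
have H5 : nrm (tens (value s) (value st) - iota y) <=
    d * (nrm ut + d) + nrm u * d + d.
  have -> : tens (value s) (value st) - iota y =
      - tens (u - value s) (value st) - tens u (ut - value st) + iota (x - y).
    by rewrite rmorphB /= xE (tensBl htens) (tensBr htens) !opprB !addrA !subrK.
  apply: le_trans (nrmD _ _) _; apply: lerD; last first.
    by apply: le_trans (nrm_morph iota_star _) _; exact: ltW.
  apply: le_trans (nrmB _ _) _; rewrite nrmN; apply: lerD.
    apply: le_trans (nrm_tens htens _ _) _; rewrite ler_pM ?nrm_ge0 ?(ltW us) //.
    apply: le_trans (nrm_le_dist _ ut) _; rewrite lerD2l nrm_distC.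
    exact: ltW.
  apply: le_trans (nrm_tens htens _ _) _.
  by rewrite ler_wpM2l ?nrm_ge0 // ltW.
apply: le_trans H4 _; apply: le_trans de; rewrite /M.
have dd : d * d <= d by rewrite ler_piMl // ltW.
have := le_trans H1 H5; lra.
Qed.
End Necessity.

(** [c] plays the part of the components of the unitary in the other leg,
    which by [unitary_degree] cannot be concentrated in a nonzero degree. *)
Lemma Fd_of_disjoint_coefs (R : realType) (J : finType) (A B : cstarType R)
    (St : J -> B) (J2 : (1 < #|J|)%N) (hSt : is_cuntz St) ut (c : int -> A) ct :
  is_coefs St ut ct ->
  (forall p q, p != q -> c p = 0 \/ ct q = 0) ->
  (forall p, p != 0 -> (forall q, q != p -> c q = 0) -> False) ->
  Fd St ut.
Proof.
move=> cut dis cne.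
suff ct0 p : p != 0 -> ct p = 0.
  exact: (closure_homog0 hSt (coefs_concentrated hSt J2 cut ct0)).
move=> p0; have [//|ctp] := eqVneq (ct p) 0; exfalso; apply: (cne p p0) => q qp.
by have [//|/eqP] := dis q p qp; rewrite (negPf ctp).
Qed.

(** * Restriction to the range *)

Section Restriction.
Variables (R : realType) (I J : finType) (A B C T : cstarType R).
Variables (S : I -> A) (St : J -> B) (U : I * J -> C).
Variables (tens : A -> B -> T) (iota : {lrmorphism C -> T}).
Hypotheses (I2 : (1 < #|I|)%N) (J2 : (1 < #|J|)%N).
Hypotheses (hS : is_cuntz S) (hSt : is_cuntz St) (hU : is_cuntz U).
Hypotheses (htens : is_cstar_tensor tens) (iota_star : star_preserving iota).
Hypothesis iotaU : forall i j, iota (U (i, j)) = tens (S i) (St j).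

Lemma Fd_of_tens_range u ut : unitary_elt u -> unitary_elt ut ->
  range iota (tens u ut) -> Fd S u /\ Fd St ut.
Proof.
move=> uu uut ran; have [c cu] := coefs_exist hS I2 u.
have [ct cut] := coefs_exist hSt J2 ut.
have dis p q : p != q -> c p = 0 \/ ct q = 0.
  move=> pq; apply: (tens_eq0 htens).
  exact: (tens_coefs_eq0 I2 J2 hS hSt hU htens iota_star iotaU ran cu cut).
have cne p : p != 0 -> (forall q, q != p -> c q = 0) -> False.
  move=> /eqP p0 H; apply: p0; apply: (unitary_degree hS I2 uu).
  exact: (coefs_concentrated hS I2 cu H).
have ctne p : p != 0 -> (forall q, q != p -> ct q = 0) -> False.
  move=> /eqP p0 H; apply: p0; apply: (unitary_degree hSt J2 uut).
  exact: (coefs_concentrated hSt J2 cut H).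
split; last exact: (Fd_of_disjoint_coefs J2 hSt cut dis cne).
apply: (Fd_of_disjoint_coefs I2 hS cu _ ctne) => p q pq.
by have [] := dis q p; [rewrite eq_sym|right|left].
Qed.

(** Raise both legs to a common level; then words of the two legs have the
    same length and combine to words in the pairs of indices. *)
Lemma range_tens_Fn n m y y' : Fn S n y -> Fn St m y' -> range iota (tens y y').
Proof.
move=> /(Fn_block hS) by_ /(Fn_block hSt) by'.
have : Fn S (n + m) y by apply/(Fn_block hS)/block_raise.
have : Fn St (n + m) y' by apply/(Fn_block hSt); rewrite addnC; apply: block_raise.
set N := (n + m)%N => -[c' ->] [c ->].
pose D := [set z | range iota z].
have DD z z' : D z -> D z' -> D (z + z').
  by move=> [x _ <-] [x' _ <-]; exists (x + x'); rewrite ?rmorphD.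
have DZ k z : D z -> D (k *: z) by move=> [x _ <-]; exists (k *: x); rewrite ?linearZ.
have D0 : D 0 by exists 0; rewrite ?rmorph0.
rewrite -/(D _) (tens_suml htens); apply: big_ind => // mu _.
rewrite (tens_suml htens); apply: big_ind => // nu _.
rewrite (tensZl htens); apply: (DZ).
rewrite (tens_sumr htens); apply: big_ind => // mu' _.
rewrite (tens_sumr htens); apply: big_ind => // nu' _.
rewrite (tensZr htens); apply: (DZ).
exists (word U (zip mu mu') * star (word U (zip nu nu'))) => //.
rewrite (iota_word2 htens iota_star iotaU).
by rewrite -!/(unzip1 _) -!/(unzip2 _) !unzip1_zip ?unzip2_zip ?size_tuple.
Qed.

(** The range of [iota] is closed, and [tens] is jointly continuous. *)
Lemma tens_Fd_range u ut : Fd S u -> Fd St ut -> range iota (tens u ut).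
Proof.
move=> /closure_nrmP hu /closure_nrmP hut.
have cl := cuntz_range_closed hU (card_prod_gt1 I2 J2) iota_star.
apply: cl; apply/closure_nrmP => e e0.
pose M := nrm u + nrm ut + 1.
have [n1 n2] := (nrm_ge0 u, nrm_ge0 ut).
have M0 : 0 < M by rewrite /M; lra.
pose d := Num.min 1 (e / M).
have d0 : 0 < d by rewrite lt_min ltr01 divr_gt0.
have d1 : d <= 1 by rewrite ge_min lexx.
have de : d * M <= e by rewrite -ler_pdivlMr // ge_min lexx orbT.
have [y [n _ Fy] uy] := hu _ d0; have [y' [m _ Fy'] uy'] := hut _ d0.
exists (tens y y'); first exact: range_tens_Fn Fy Fy'.
have -> : tens u ut - tens y y' = tens (u - y) ut + tens y (ut - y').
  by rewrite (tensBl htens) (tensBr htens) addrA subrK.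
apply: le_lt_trans (nrmD _ _) _.
have H1 := nrm_tens htens (u - y) ut; have H2 := nrm_tens htens y (ut - y').
have H3 : nrm y <= nrm u + nrm (u - y) by rewrite nrm_distC nrm_le_dist.
have [[n3 n4] n5] := (nrm_ge0 (u - y), nrm_ge0 (ut - y'), nrm_ge0 y).
rewrite /M in de; nra.
Qed.

(** On generators [Phi] is multiplication by [tens u ut]. In one direction,
    the elements that [Phi] maps into the closed range form a closed
    star-subalgebra; in the other, [tens u ut] is recovered as the sum of the
    [Phi (iota U_p) (iota U_p)^*]. *)
Lemma restricts_along_of_tens u ut (Phi : {lrmorphism T -> T}) :
  star_preserving Phi ->
  (forall i j, Phi (tens (S i) (St j)) = tens (u * S i) (ut * St j)) ->
  range iota (tens u ut) <-> restricts_along iota Phi.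
Proof.
move=> Phis PhiU.
have PE i j : Phi (iota (U (i, j))) = tens u ut * iota (U (i, j)).
  by rewrite iotaU PhiU (tensM htens).
split=> [[w _ wE]|res].
- pose D := [set x | range iota (Phi (iota x))].
  suff DT : D = setT.
    by move=> _ [_ [x _ <-] <-]; have : D x by rewrite DT.
  apply: (cuntz_generated hU).
  + apply/closure_id/seteqP; split; first exact: subset_closure.
    move=> x /closure_nrmP hx.
    apply: (cuntz_range_closed hU (card_prod_gt1 I2 J2) iota_star).
    apply/closure_nrmP => e /hx[y [z _ zE] xy]; exists (Phi (iota y)).
      by exists z.
    rewrite -!rmorphB; apply: le_lt_trans xy.
    by apply: le_trans (nrm_morph Phis _) (nrm_morph iota_star _).
  + split.
    * move=> c x y [x' _ xE] [y' _ yE]; exists (c *: x' + y') => //.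
      by rewrite !linearP /= xE yE.
    * move=> x y [x' _ xE] [y' _ yE]; exists (x' * y') => //.
      by rewrite !rmorphM /= xE yE.
    * move=> x [x' _ xE]; exists (star x') => //.
      by rewrite iota_star xE -Phis -iota_star.
  + by move=> [i j]; exists (w * U (i, j)); rewrite // PE rmorphM /= wE.
- have -> : tens u ut = \sum_p Phi (iota (U p)) * star (iota (U p)).
    transitivity (tens u ut * iota (\sum_p U p * star (U p))).
      by rewrite (cuntz_sum hU) rmorph1 mulr1.
    rewrite rmorph_sum mulr_sumr; apply: eq_bigr => -[i j] _ /=.
    by rewrite rmorphM /= iota_star mulrA PE.
  apply: big_ind => [|_ _ [x _ <-] [y _ <-]|p _].
  + by exists 0; rewrite ?rmorph0.
  + by exists (x + y); rewrite ?rmorphD.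
  + have [|x _ <-] := res (Phi (iota (U p))).
      by exists (iota (U p)) => //; exists (U p).
    by exists (x * star (U p)); rewrite // rmorphM /= iota_star.
Qed.

End Restriction.

(** * The product of two R-matrices *)

Lemma sum_tuple_pair (V : zmodType) (I J : finType) n
    (F : n.-tuple I -> n.-tuple J -> V) :
  \sum_(mu : n.-tuple (I * J)) F [tuple of map fst mu] [tuple of map snd mu] =
  \sum_mu \sum_nu F mu nu.
Proof.
rewrite pair_bigA /=.
rewrite (reindex (fun mu : n.-tuple (I * J) =>
  ([tuple of map fst mu], [tuple of map snd mu]))) //=.
exists (fun p : n.-tuple I * n.-tuple J => [tuple of zip p.1 p.2]) =>
  [mu _|[mu nu] _] /=.
  by apply: val_inj; rewrite /= -/(unzip1 _) -/(unzip2 _) zip_unzip.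
congr (_, _); apply: val_inj => /=; rewrite -?/(unzip1 _) -?/(unzip2 _).
  by rewrite unzip1_zip ?size_tuple.
by rewrite unzip2_zip ?size_tuple.
Qed.

Section Box.
Variables (R : realType) (I J : finType) (A B C T : cstarType R).
Variables (S : I -> A) (St : J -> B) (U : I * J -> C).
Variables (tens : A -> B -> T) (iota : {lrmorphism C -> T}).
Hypotheses (htens : is_cstar_tensor tens) (iota_star : star_preserving iota).
Hypothesis iotaU : forall i j, iota (U (i, j)) = tens (S i) (St j).

Lemma iota_boxtimes M Mt :
  iota (of_matrix U (boxtimes M Mt)) = tens (of_matrix S M) (of_matrix St Mt).
Proof.
rewrite rmorph_sum /= (tens_suml htens).
transitivity (\sum_mu \sum_mut \sum_nu \sum_nut (M mu nu * Mt mut nut) *: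
   tens (word S mu * star (word S nu)) (word St mut * star (word St nut))).
  rewrite -sum_tuple_pair; apply: eq_bigr => mu _.
  rewrite rmorph_sum /= -sum_tuple_pair; apply: eq_bigr => nu _.
  by rewrite linearZ /= (iota_word2 htens iota_star iotaU).
apply: eq_bigr => mu _; rewrite exchange_big (tens_suml htens) /=.
apply: eq_bigr => nu _; rewrite (tens_sumr htens); apply: eq_bigr => mut _.
rewrite (tens_sumr htens); apply: eq_bigr => nut _.
by rewrite (tensZl htens) (tensZr htens) scalerA.
Qed.

(** As [iota] is injective, the preimages of the values of [Phi \o iota] are
    unique and inherit the algebraic properties of [Phi]. *)
Lemma lrmorphism_restriction (Phi : {lrmorphism T -> T}) :
  injective iota -> star_preserving Phi -> restricts_along iota Phi ->
  exists2 lam : {lrmorphism C -> C},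
    star_preserving lam & forall x, Phi (iota x) = iota (lam x).
Proof.
move=> iinj Phis res.
have /choice[f fE] x : exists y, iota y = Phi (iota x).
  have [|y _ yE] := res (Phi (iota x)); last by exists y.
  by exists (iota x) => //; exists x.
have [||| lam lamE] := @lrmorphism_of _ _ _ f.
- by move=> c x y; apply: iinj; rewrite !linearP /= !fE !linearP.
- by move=> x y; apply: iinj; rewrite rmorphM /= !fE !rmorphM.
- by apply: iinj; rewrite fE !rmorph1.
exists lam => x; last by rewrite lamE fE.
by apply: iinj; rewrite !lamE iota_star !fE iota_star Phis.
Qed.

End Box.

Theorem lemma4p1 (R : realType) (d dt : nat) (Od Odt Oddt T : cstarType R)
    (S : 'I_d -> Od) (St : 'I_dt -> Odt) (U : 'I_d * 'I_dt -> Oddt)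
    (tens : Od -> Odt -> T) (iota : {lrmorphism Oddt -> T})
    (hd : (2 <= d)%N) (hdt : (2 <= dt)%N)
    (hS : is_cuntz S) (hSt : is_cuntz St) (hU : is_cuntz U)
    (htens : is_cstar_tensor tens)
    (iota_star : star_preserving iota) (iota_inj : injective iota)
    (iotaU : forall i j, iota (U (i, j)) = tens (S i) (St j)) :
  (forall (u : Od) (ut : Odt)
      (lam : {lrmorphism Od -> Od}) (lamt : {lrmorphism Odt -> Odt})
      (Phi : {lrmorphism T -> T}),
    unitary_elt u -> unitary_elt ut ->
    is_lambda S u lam -> is_lambda St ut lamt ->
    is_tensor_endo tens lam lamt Phi ->
    (restricts_along iota Phi <-> Fd S u /\ Fd St ut))
  /\
  (forall (M : 2.-tuple 'I_d -> 2.-tuple 'I_d -> R[i])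
      (Mt : 2.-tuple 'I_dt -> 2.-tuple 'I_dt -> R[i]),
    unitary_elt (of_matrix S M) -> unitary_elt (of_matrix St Mt) ->
    iota (of_matrix U (boxtimes M Mt)) =
      tens (of_matrix S M) (of_matrix St Mt)
    /\
    (forall (lam : {lrmorphism Od -> Od}) (lamt : {lrmorphism Odt -> Odt})
        (Phi : {lrmorphism T -> T}),
      is_lambda S (of_matrix S M) lam ->
      is_lambda St (of_matrix St Mt) lamt ->
      is_tensor_endo tens lam lamt Phi ->
      exists lamU : {lrmorphism Oddt -> Oddt},
        is_lambda U (of_matrix U (boxtimes M Mt)) lamU /\
        forall x, Phi (iota x) = iota (lamU x))).
Proof.
have I2 : (1 < #|'I_d|)%N by rewrite card_ord.
have J2 : (1 < #|'I_dt|)%N by rewrite card_ord.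
have PhiU u ut (lam : {lrmorphism Od -> Od}) (lamt : {lrmorphism Odt -> Odt})
    (Phi : {lrmorphism T -> T}) : is_lambda S u lam -> is_lambda St ut lamt ->
    is_tensor_endo tens lam lamt Phi ->
    forall i j, Phi (tens (S i) (St j)) = tens (u * S i) (ut * St j).
  by move=> [_ lE] [_ ltE] [_ PE] i j; rewrite PE lE ltE.
have res u ut (lam : {lrmorphism Od -> Od}) (lamt : {lrmorphism Odt -> Odt})
    (Phi : {lrmorphism T -> T}) : is_lambda S u lam -> is_lambda St ut lamt ->
    is_tensor_endo tens lam lamt Phi ->
    range iota (tens u ut) <-> restricts_along iota Phi.
  move=> hl hlt hP.
  by apply: (restricts_along_of_tens I2 J2 hU htens iota_star iotaU);
    [case: hP | exact: PhiU hl hlt hP].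
split=> [u ut lam lamt Phi uu uut hl hlt hP | M Mt uM uMt].
  rewrite -(res _ _ _ _ _ hl hlt hP); split=> [|[]].
    exact: (Fd_of_tens_range I2 J2 hS hSt hU htens iota_star iotaU).
  exact: (tens_Fd_range I2 J2 hS hSt hU htens iota_star iotaU).
have box := iota_boxtimes htens iota_star iotaU M Mt.
split=> // lam lamt Phi hl hlt hP.
have [lamU lamUs lamUE] : exists2 lamU : {lrmorphism Oddt -> Oddt},
    star_preserving lamU & forall x, Phi (iota x) = iota (lamU x).
  apply: lrmorphism_restriction => //; first by case: hP.
  apply/(res _ _ _ _ _ hl hlt hP).
  by exists (of_matrix U (boxtimes M Mt)).
exists lamU; split=> //; split=> // -[i j]; apply: iota_inj.
rewrite -lamUE iotaU (PhiU _ _ _ _ _ hl hlt hP).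
by rewrite rmorphM /= box iotaU (tensM htens).
Qed.
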